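(* Let $a,b,c\in\mathbb R$ and let $(u_1,u_2,p_{u_1},p_{u_2})$ be parabolic coordinates and their conjugate momenta on $T^*\mathbb R^2$. Let $\hat u_1,\hat u_2$ be the roots $x$ of the polynomial $$\left(a-\frac{(p_{u_1}-p_{u_2})^2}{(u_1-u_2)^2}\right)x^2+\left(a(u_1+u_2)+b-\frac{p_{u_1}^2-p_{u_2}^2}{u_1-u_2}\right)x+\left(a(u_1^2+u_1u_2+u_2^2)+b(u_1+u_2)+c-\frac{u_1p_{u_1}^2-u_2p_{u_2}^2}{u_1-u_2}\right),$$ and let $$\hat p_{u_i}=-\hat u_i^{-1}Q(\hat u_i),\qquad Q(x)=x\left(\frac{(x-u_2)p_{u_1}}{u_1-u_2}+\frac{(x-u_1)p_{u_2}}{u_2-u_1}\right),\qquad i=1,2.$$ Then: 1. These variables are canonical on $T^*\mathbb R^2$: $\{\hat u_i,\hat p_{u_j}\}=\delta_{ij}$ and $\{\hat u_1,\hat u_2\}=\{\hat p_{u_1},\hat p_{u_2}\}=0$. 2. Substituting these variables into the separation relations $$2\lambda_i=\hat u_i\hat p_{u_i}^2-a\hat u_i^3-b\hat u_i^2-c\hat u_i=\hat H_1\pm\sqrt{\hat H_2},\qquad i=1,2,$$ (sign $+$ for one value of $i$, $-$ for the other) and solving for $\hat H_1,\hat H_2$, one gets the Hamilton function $$\hat H_1=\frac{u_1(2u_1+u_2)p_{u_1}^2}{u_1-u_2}+\frac{u_2(u_1+2u_2)p_{u_2}^2}{u_2-u_1}-a(u_1+u_2)(2u_1^2+u_1u_2+2u_2^2)-b(2u_1^2+3u_1u_2+2u_2^2)-2c(u_1+u_2)$$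 and the second integral of motion ($\{\hat H_1,\hat H_2\}=0$), which is a polynomial of fourth order in the momenta, $$\hat H_2=u_1^2u_2^2\Bigl(\tfrac{(p_{u_1}-p_{u_2})^3\left((3u_1+u_2)p_{u_1}+(u_1+3u_2)p_{u_2}\right)}{(u_1-u_2)^3}-\tfrac{4c(p_{u_1}-p_{u_2})^2}{(u_1-u_2)^2}$$ $$-\tfrac{2a\left(3(u_1^2+u_2^2)(p_{u_1}^2+p_{u_2}^2)-4(u_1^2+u_1u_2+u_2^2)p_{u_1}p_{u_2}\right)}{(u_1-u_2)^2}-\tfrac{2b(p_{u_1}-p_{u_2})\left((u_1+3u_2)p_{u_1}-(3u_1+u_2)p_{u_2}\right)}{(u_1-u_2)^2}$$ $$+a^2(3u_1^2+2u_1u_2+3u_2^2)+a\bigl(2b(u_1+u_2)+4c\bigr)-b^2\Bigr).$$ 3. The vector field associated with the Hamiltonian $\hat H_1$ is bi-Hamiltonian with respect to the compatible Poisson brackets $\{\cdot,\cdot\}$ and $\{\cdot,\cdot\}'$, where $\{\hat u_i,\hat p_{u_j}\}'=\lambda_i^{-1}\delta_{ij}$, $\{\hat u_1,\hat u_2\}'=\{\hat p_{u_1},\hat p_{u_2}\}'=0$.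
   Context: The bracket $\{\cdot,\cdot\}$ is the canonical one, $\{u_i,p_{u_j}\}=\delta_{ij}$, $\{u_1,u_2\}=\{p_{u_1},p_{u_2}\}=0$. Parabolic coordinates on the plane with Cartesian coordinates $(q_1,q_2)$ are $u_1=q_2-\sqrt{q_1^2+q_2^2}$, $u_2=q_2+\sqrt{q_1^2+q_2^2}$. Two Poisson brackets are compatible if every linear combination of them is a Poisson bracket; a vector field is bi-Hamiltonian with respect to two compatible brackets if it is Hamiltonian (with possibly different Hamiltonian functions) for both. All formulas are understood where the expressions involved are defined.
   Formalization: In part 2 the constants are corrected: solving the separation relations gives half of the displayed Ĥ1 and −1/4 of the displayed Ĥ2; roots are taken real, continuous and non-zero, distinct in parts 1 and 3, with λ_i ≠ 0 in part 3. *)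

(* Defs.v *)
From Stdlib Require Import Reals.
From Coquelicot Require Import Coquelicot.
Open Scope R_scope.

(** A point is [(u_1, u_2, p_{u_1}, p_{u_2})]. *)
Notation phase := (R * R * R * R)%type.

Definition u1 (z : phase) : R := fst (fst (fst z)).
Definition u2 (z : phase) : R := snd (fst (fst z)).
Definition pu1 (z : phase) : R := snd (fst z).
Definition pu2 (z : phase) : R := snd z.

(** The part of the phase space on which [(u, p_u)] is a coordinate system:
    on the line [q1 = 0] the Jacobian of [q |-> u] degenerates and the momenta
    conjugate to [u] do not exist.  It is the open set [u1 < 0 < u2]. *)
Definition parabolic_chart (z : phase) : Prop :=
  exists q1 q2 : R, q1 <> 0 /\
    u1 z = q2 - sqrt (q1 ^ 2 + q2 ^ 2) /\
    u2 z = q2 + sqrt (q1 ^ 2 + q2 ^ 2).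

Inductive coord : Set := U1 | U2 | P1 | P2.

Definition get (i : coord) (z : phase) : R :=
  match i with U1 => u1 z | U2 => u2 z | P1 => pu1 z | P2 => pu2 z end.

Definition set (i : coord) (t : R) (z : phase) : phase :=
  match i with
  | U1 => (t, u2 z, pu1 z, pu2 z)
  | U2 => (u1 z, t, pu1 z, pu2 z)
  | P1 => (u1 z, u2 z, t, pu2 z)
  | P2 => (u1 z, u2 z, pu1 z, t)
  end.

Definition sum_coord (F : coord -> R) : R := F U1 + F U2 + F P1 + F P2.

Definition partial (i : coord) (f : phase -> R) (z : phase) : R :=
  Derive (fun t => f (set i t z)) (get i z).

(** [C^n] and [C^oo] on a set [M], meant for open [M]. *)
Fixpoint class_C (n : nat) (M : phase -> Prop) (f : phase -> R) : Prop :=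
  (forall z, M z -> continuous f z) /\
  match n with
  | O => True
  | S m => forall i,
      (forall z, M z -> ex_derive (fun t => f (set i t z)) (get i z)) /\
      class_C m M (partial i f)
  end.

Definition smooth (M : phase -> Prop) (f : phase -> R) : Prop :=
  forall n, class_C n M f.

(** Contravariant 2-tensors, given by their components in the chart. *)
Definition tensor2 : Type := coord -> coord -> phase -> R.

Definition bracket (Pi : tensor2) (f g : phase -> R) (z : phase) : R :=
  sum_coord (fun i => sum_coord (fun j =>
    Pi i j z * partial i f z * partial j g z)).

Definition bivector_field (M : phase -> Prop) (Pi : tensor2) : Prop :=
  (forall i j, smooth M (Pi i j)) /\
  (forall i j z, M z -> Pi i j z = - Pi j i z).

(** Bilinearity and the Leibniz rule hold for every [bracket Pi]; antisymmetry
    is that of the bivector field. *)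
Definition poisson (M : phase -> Prop) (Pi : tensor2) : Prop :=
  bivector_field M Pi /\
  (forall f g h, smooth M f -> smooth M g -> smooth M h ->
    forall z, M z ->
      bracket Pi (bracket Pi f g) h z + bracket Pi (bracket Pi g h) f z
      + bracket Pi (bracket Pi h f) g z = 0).

Definition lin_comb (al : R) (Pi1 : tensor2) (be : R) (Pi2 : tensor2) : tensor2 :=
  fun i j z => al * Pi1 i j z + be * Pi2 i j z.

Definition compatible (M : phase -> Prop) (Pi1 Pi2 : tensor2) : Prop :=
  forall al be : R, poisson M (lin_comb al Pi1 be Pi2).

Definition canonical : tensor2 := fun i j _ =>
  match i, j with
  | U1, P1 | U2, P2 => 1
  | P1, U1 | P2, U2 => -1
  | _, _ => 0
  end.

(** [i]-th component of the Hamiltonian vector field of [H], i.e.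
    the bracket of the [i]-th coordinate with [H]. *)
Definition ham_field (Pi : tensor2) (H : phase -> R) : coord -> phase -> R :=
  fun i z => sum_coord (fun j => Pi i j z * partial j H z).

Definition hamiltonian (M : phase -> Prop) (Pi : tensor2)
    (X : coord -> phase -> R) : Prop :=
  exists F, smooth M F /\ forall i z, M z -> X i z = ham_field Pi F i z.

Definition bi_hamiltonian (M : phase -> Prop) (Pi1 Pi2 : tensor2)
    (X : coord -> phase -> R) : Prop :=
  compatible M Pi1 Pi2 /\ hamiltonian M Pi1 X /\ hamiltonian M Pi2 X.

(** [{x_i, y_j} = delta_ij m_i] and [{x_1, x_2} = {y_1, y_2} = 0] on [M]. *)
Definition has_brackets (M : phase -> Prop) (Pi : tensor2)
    (x1 x2 y1 y2 m1 m2 : phase -> R) : Prop :=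
  forall z, M z ->
    bracket Pi x1 y1 z = m1 z /\ bracket Pi x2 y2 z = m2 z /\
    bracket Pi x1 y2 z = 0 /\ bracket Pi x2 y1 z = 0 /\
    bracket Pi x1 x2 z = 0 /\ bracket Pi y1 y2 z = 0.

Definition coefA (a : R) (z : phase) : R :=
  a - (pu1 z - pu2 z) ^ 2 / (u1 z - u2 z) ^ 2.
Definition coefB (a b : R) (z : phase) : R :=
  a * (u1 z + u2 z) + b - (pu1 z ^ 2 - pu2 z ^ 2) / (u1 z - u2 z).
Definition coefC (a b c : R) (z : phase) : R :=
  a * (u1 z ^ 2 + u1 z * u2 z + u2 z ^ 2) + b * (u1 z + u2 z) + c
  - (u1 z * pu1 z ^ 2 - u2 z * pu2 z ^ 2) / (u1 z - u2 z).

(** [x1], [x2] are the two roots, counted with multiplicity, of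
    [A x^2 + B x + C]. *)
Definition quadratic_roots (A B C x1 x2 : R) : Prop :=
  A <> 0 /\ forall x : R, A * x ^ 2 + B * x + C = A * (x - x1) * (x - x2).

Definition Qpol (z : phase) (x : R) : R :=
  x * ((x - u2 z) * pu1 z / (u1 z - u2 z) + (x - u1 z) * pu2 z / (u2 z - u1 z)).

(** The momentum conjugate to the root [x]. *)
Definition phat (x : phase -> R) (z : phase) : R := - / x z * Qpol z (x z).

(** [lambda_i], as a function of [(x, y)], the [i]-th pair of new variables. *)
Definition lambda (a b c : R) (x y : phase -> R) (z : phase) : R :=
  (x z * y z ^ 2 - a * x z ^ 3 - b * x z ^ 2 - c * x z) / 2.

(** Normalization: in terms of the separation relations, [Hhat1] is
    [2 (lambda_1 + lambda_2)] and [Hhat2] is [- 4 (lambda_1 - lambda_2)^2]. *)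
Definition Hhat1 (a b c : R) (z : phase) : R :=
  let u := u1 z in let v := u2 z in let p := pu1 z in let q := pu2 z in
  u * (2 * u + v) * p ^ 2 / (u - v) + v * (u + 2 * v) * q ^ 2 / (v - u)
  - a * (u + v) * (2 * u ^ 2 + u * v + 2 * v ^ 2)
  - b * (2 * u ^ 2 + 3 * u * v + 2 * v ^ 2)
  - 2 * c * (u + v).

Definition Hhat2 (a b c : R) (z : phase) : R :=
  let u := u1 z in let v := u2 z in let p := pu1 z in let q := pu2 z in
  u ^ 2 * v ^ 2 *
  ( (p - q) ^ 3 * ((3 * u + v) * p + (u + 3 * v) * q) / (u - v) ^ 3
    - 4 * c * (p - q) ^ 2 / (u - v) ^ 2
    - 2 * a * (3 * (u ^ 2 + v ^ 2) * (p ^ 2 + q ^ 2)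
               - 4 * (u ^ 2 + u * v + v ^ 2) * p * q) / (u - v) ^ 2
    - 2 * b * (p - q) * ((u + 3 * v) * p - (3 * u + v) * q) / (u - v) ^ 2
    + a ^ 2 * (3 * u ^ 2 + 2 * u * v + 3 * v ^ 2)
    + a * (2 * b * (u + v) + 4 * c) - b ^ 2 ).

(** Solutions [(h1, h2)] of [2 l1 = h1 + sqrt h2], [2 l2 = h1 - sqrt h2], or of
    the same with the signs exchanged.  [sqrt] is [0] on negative reals, whence
    the first condition. *)
Definition separation_relations (l1 l2 h1 h2 : R) : Prop :=
  0 <= h2 /\
  ((2 * l1 = h1 + sqrt h2 /\ 2 * l2 = h1 - sqrt h2) \/
   (2 * l1 = h1 - sqrt h2 /\ 2 * l2 = h1 + sqrt h2)).

(** Polynomial of total degree exactly [n] in the momenta over every point of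
    the configuration space, with coefficients depending on [(u_1, u_2)]. *)
Definition momentum_polynomial (n : nat) (f : phase -> R) : Prop :=
  exists k : nat -> nat -> R -> R -> R,
    (forall z, parabolic_chart z ->
      f z = sum_f_R0 (fun i => sum_f_R0 (fun j =>
              k i j (u1 z) (u2 z) * pu1 z ^ i * pu2 z ^ j) (n - i)) n) /\
    (forall z, parabolic_chart z ->
      exists i, (i <= n)%nat /\ k i (n - i)%nat (u1 z) (u2 z) <> 0).

(* Main.v *)
(** Let [y = s x + k] be the line through the points [(u_i, p_i)].  Then
    [y_i = - (s x_i + k)], the quadratic has coefficients [A = a - s^2],
    [B = A (u_1 + u_2) + b - 2 s k] and
    [C = A (u_1^2 + u_1 u_2 + u_2^2) + (b - 2 s k) (u_1 + u_2) + c - k^2], and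
    reducing the cubic [2 lambda_i] modulo [A x^2 + B x + C] gives
    [2 lambda_i = - A u_1 u_2 x_i - (u_1 + u_2) C].  Hence
    [Hhat1 = u_1 u_2 B - 2 (u_1 + u_2) C] and
    [Hhat2 = (u_1 u_2)^2 (4 A C - B^2)].

    A simple root is smooth because [A (x_1 - x_2)] is a continuous square root of
    the discriminant; its derivatives follow by implicit differentiation, and
    canonicity becomes a rational identity once [b] is eliminated by Vieta's
    formulas.  The vector fields [{., y_i}] and [{x_i, .}] commute, so the brackets
    [sum_i m_i d/dx_i /\ d/dy_i] with [m_i] a function of [(x_i, y_i)] satisfy the
    Jacobi identity.  The second Hamiltonian is [lambda_1^2 + lambda_2^2]. *)

Require Import Defs.
From Stdlib Require Import Reals Lra Lia.
From Coquelicot Require Import Coquelicot.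
Open Scope R_scope.

(** * Partial derivatives and smooth functions *)

Lemma get_set_eq i t z : get i (set i t z) = t.
Proof. destruct i; reflexivity. Qed.

Lemma get_set_neq i j t z : i <> j -> get i (set j t z) = get i z.
Proof. destruct i, j; easy. Qed.

Lemma set_get i z : set i (get i z) z = z.
Proof. destruct z as [[[? ?] ?] ?]; destruct i; reflexivity. Qed.

Lemma set_set i s t z : set i s (set i t z) = set i s z.
Proof. destruct i; reflexivity. Qed.

Lemma set_comm i j s t z :
  i <> j -> set i s (set j t z) = set j t (set i s z).
Proof. destruct i, j; easy. Qed.

(** Ends with [Defined], so that [kron] reduces on concrete coordinates. *)
Lemma coord_eq_dec (i j : coord) : {i = j} + {i <> j}.
Proof. decide equality. Defined.

Lemma continuous_pair {T U V : UniformSpace} (f : T -> U) (g : T -> V) x :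
  continuous f x -> continuous g x -> continuous (fun t => (f t, g t)) x.
Proof.
  intros Hf Hg. apply (continuous_comp_2 f g (fun a b => (a, b)) x Hf Hg).
  apply continuous_ext with (f := fun w : U * V => w).
  - now intros [? ?].
  - apply continuous_id.
Qed.

Lemma continuous_get i z : continuous (get i) z.
Proof.
  destruct z as [[[u v] p] q].
  destruct i; cbn [get]; unfold u1, u2, pu1, pu2;
    repeat first
      [ apply continuous_fst | apply continuous_snd
      | apply (continuous_comp fst fst) | apply (continuous_comp fst snd)
      | apply (continuous_comp (fun w : phase => fst (fst w)) fst)
      | apply (continuous_comp (fun w : phase => fst (fst w)) snd) ].
Qed.

Lemma continuous_set {T : UniformSpace} i (f : T -> R) (g : T -> phase) x :
  continuous f x -> continuous g x -> continuous (fun t => set i (f t) (g t)) x.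
Proof.
  intros Hf Hg.
  assert (H : forall j, continuous (fun t => get j (g t)) x).
  { intros j. apply (continuous_comp g (get j)); [exact Hg | apply continuous_get]. }
  pose proof (H U1); pose proof (H U2); pose proof (H P1); pose proof (H P2).
  destruct i; cbn [set]; repeat apply continuous_pair; assumption.
Qed.

Lemma continuous_set_l i z t : continuous (fun s => set i s z) t.
Proof.
  apply (continuous_set i (fun s : R => s)).
  - apply continuous_id.
  - apply continuous_const.
Qed.

Lemma locally_set_at (M : phase -> Prop) i t z :
  open M -> M (set i t z) -> locally t (fun s => M (set i s z)).
Proof. intros HM Hz. apply (continuous_set_l i z t M). now apply HM. Qed.

Lemma locally_set (M : phase -> Prop) i z :
  open M -> M z -> locally (get i z) (fun t => M (set i t z)).
Proof. intros HM Hz. apply locally_set_at; [exact HM | now rewrite set_get]. Qed.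

(** Relational counterpart of [partial]. As [Derive] is total, an equation for [partial] says
    nothing about differentiability; [is_partial] asserts it together with the value. *)
Definition is_partial (i : coord) (f : phase -> R) (z : phase) (l : R) : Prop :=
  is_derive (fun t => f (set i t z)) (get i z) l.

Lemma is_partial_unique i f z l : is_partial i f z l -> partial i f z = l.
Proof. apply is_derive_unique. Qed.

Lemma partial_correct i f z :
  ex_derive (fun t => f (set i t z)) (get i z) -> is_partial i f z (partial i f z).
Proof. apply Derive_correct. Qed.

Lemma is_partial_ex i f z l :
  is_partial i f z l -> ex_derive (fun t => f (set i t z)) (get i z).
Proof. now exists l. Qed.

Lemma is_partial_eq i f z l l' : is_partial i f z l -> l = l' -> is_partial i f z l'.
Proof. now intros H <-. Qed.

Lemma is_partial_ext (M : phase -> Prop) i f g z l :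
  open M -> M z -> (forall w, M w -> f w = g w) ->
  is_partial i f z l -> is_partial i g z l.
Proof.
  intros HM Hz E. apply is_derive_ext_loc.
  generalize (locally_set M i z HM Hz). apply filter_imp. intros t Ht. now apply E.
Qed.

Lemma partial_ext (M : phase -> Prop) i f g z :
  open M -> M z -> (forall w, M w -> f w = g w) -> partial i f z = partial i g z.
Proof.
  intros HM Hz E. apply Derive_ext_loc.
  generalize (locally_set M i z HM Hz). apply filter_imp. intros t Ht. now apply E.
Qed.

Lemma is_partial_const i c z : is_partial i (fun _ => c) z 0.
Proof. exact (is_derive_const (K := R_AbsRing) (V := R_NormedModule) c (get i z)). Qed.

Lemma is_partial_get i j z :
  is_partial i (get j) z (if coord_eq_dec i j then 1 else 0).
Proof.
  unfold is_partial. destruct (coord_eq_dec i j) as [<- | Hij].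
  - apply is_derive_ext with (f := fun t => t).
    + intros t. now rewrite get_set_eq.
    + apply (is_derive_id (K := R_AbsRing)).
  - apply is_derive_ext with (f := fun _ => get j z).
    + intros t. now rewrite get_set_neq by congruence.
    + apply is_partial_const.
Qed.

Lemma is_partial_plus i f g z l m :
  is_partial i f z l -> is_partial i g z m ->
  is_partial i (fun w => f w + g w) z (l + m).
Proof. intros Hf Hg. apply (is_derive_plus (K := R_AbsRing) _ _ _ _ _ Hf Hg). Qed.

Lemma is_partial_mult i f g z l m :
  is_partial i f z l -> is_partial i g z m ->
  is_partial i (fun w => f w * g w) z (l * g z + f z * m).
Proof.
  intros Hf Hg.
  generalize (is_derive_mult (K := R_AbsRing) _ _ _ _ _ Hf Hg Rmult_comm).
  now rewrite set_get.
Qed.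

Lemma is_partial_inv i f z l :
  f z <> 0 -> is_partial i f z l ->
  is_partial i (fun w => / f w) z (- l * (/ f z * / f z)).
Proof.
  intros H0 Hf. generalize (is_derive_inv _ _ _ Hf).
  rewrite set_get. intros H. apply is_partial_eq with (1 := H H0). now field.
Qed.

Lemma class_C_continuous n M f z : class_C n M f -> M z -> continuous f z.
Proof. destruct n; intros [H _]; auto. Qed.

Lemma class_C_S n M f :
  (forall z, M z -> continuous f z) ->
  (forall i, (forall z, M z -> ex_derive (fun t => f (set i t z)) (get i z)) /\
             class_C n M (partial i f)) ->
  class_C (S n) M f.
Proof. intros H H'. split; assumption. Qed.

Lemma class_C_pred n M f : class_C (S n) M f -> class_C n M f.
Proof.
  revert f. induction n as [|n IH]; intros f [Hc Hd].
  - split; [exact Hc | exact I].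
  - split; [exact Hc | intros i]. destruct (Hd i) as [H1 H2]. split; auto.
Qed.

Lemma class_C_ext n M f g :
  open M -> (forall z, M z -> f z = g z) -> class_C n M f -> class_C n M g.
Proof.
  intros HM. revert f g. induction n as [|n IH]; intros f g E [Hc Hd].
  all: assert (Hg : forall z, M z -> continuous g z).
  1, 3: intros z Hz; apply continuous_ext_loc with (g := f); [|now apply Hc];
    generalize (HM z Hz); apply filter_imp; exact E.
  - split; [exact Hg | exact I].
  - split; [exact Hg | intros i]. destruct (Hd i) as [H1 H2]. split.
    + intros z Hz. apply is_partial_ex with (partial i f z).
      apply is_partial_ext with M f; auto. now apply partial_correct, H1.
    + apply IH with (partial i f); [|exact H2].
      intros z Hz. now apply partial_ext with M.
Qed.

(** The entry point of the inductions on the order: a formula [d] valid on the open set [M] may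
    stand for the partials, because [class_C] depends only on values on [M]. *)
Lemma class_C_S_intro n (M : phase -> Prop) f (d : coord -> phase -> R) :
  open M -> (forall z, M z -> continuous f z) ->
  (forall i z, M z -> is_partial i f z (d i z)) ->
  (forall i, class_C n M (d i)) -> class_C (S n) M f.
Proof.
  intros HM Hc Hp Hd. apply class_C_S; [exact Hc | intros i; split].
  - intros z Hz. now apply is_partial_ex with (d i z), Hp.
  - apply class_C_ext with (d i); auto.
    intros z Hz. symmetry. now apply is_partial_unique, Hp.
Qed.

Lemma class_C_partial n M f i z :
  class_C (S n) M f -> M z -> is_partial i f z (partial i f z).
Proof. intros [_ H] Hz. now apply partial_correct, H. Qed.

Lemma class_C_const n M c : open M -> class_C n M (fun _ => c).
Proof.
  intros HM. revert c. induction n as [|n IH]; intros c.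
  - split; [intros; apply continuous_const | exact I].
  - apply class_C_S_intro with (fun _ _ => 0); auto.
    + intros; apply continuous_const.
    + intros; apply is_partial_const.
Qed.

Lemma class_C_get n M i : open M -> class_C n M (get i).
Proof.
  intros HM. destruct n as [|n].
  - split; [intros; apply continuous_get | exact I].
  - apply class_C_S_intro with (fun j _ => if coord_eq_dec j i then 1 else 0); auto.
    + intros; apply continuous_get.
    + intros; apply is_partial_get.
    + intros; now apply class_C_const.
Qed.

Lemma class_C_plus n M f g :
  open M -> class_C n M f -> class_C n M g -> class_C n M (fun z => f z + g z).
Proof.
  intros HM. revert f g. induction n as [|n IH]; intros f g Hf Hg.
  all: assert (Hc : forall z, M z -> continuous (fun z => f z + g z) z).
  1, 3: intros z Hz; apply (continuous_plus (K := R_AbsRing) (V := R_NormedModule));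
    eapply class_C_continuous; eassumption.
  - split; [exact Hc | exact I].
  - apply class_C_S_intro with (fun i z => partial i f z + partial i g z); auto.
    + intros i z Hz. apply is_partial_plus; eapply class_C_partial; eassumption.
    + intros i. apply IH; [apply Hf | apply Hg].
Qed.

(** The Leibniz formula contains the undifferentiated factors, which enter at the lower order
    through [class_C_pred]. *)
Lemma class_C_mult n M f g :
  open M -> class_C n M f -> class_C n M g -> class_C n M (fun z => f z * g z).
Proof.
  intros HM. revert f g. induction n as [|n IH]; intros f g Hf Hg.
  all: assert (Hc : forall z, M z -> continuous (fun z => f z * g z) z).
  1, 3: intros z Hz; apply (continuous_mult (K := R_AbsRing));
    eapply class_C_continuous; eassumption.
  - split; [exact Hc | exact I].
  - apply class_C_S_intro with
      (fun i z => partial i f z * g z + f z * partial i g z); auto.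
    + intros i z Hz. apply is_partial_mult; eapply class_C_partial; eassumption.
    + intros i. apply class_C_plus; auto; apply IH;
        solve [apply Hf | apply Hg | now apply class_C_pred].
Qed.

(** The derivative of [/ f] is expressed by [/ f] itself at one order less, which is the induction
    hypothesis. *)
Lemma class_C_inv n M f :
  open M -> (forall z, M z -> f z <> 0) -> class_C n M f -> class_C n M (fun z => / f z).
Proof.
  intros HM H0. induction n as [|n IH]; intros Hf.
  all: assert (Hc : forall z, M z -> continuous (fun z => / f z) z).
  1, 3: intros z Hz; apply (continuous_comp f Rinv);
    [eapply class_C_continuous; eassumption | now apply continuous_Rinv, H0].
  - split; [exact Hc | exact I].
  - apply class_C_S_intro with
      (fun i z => - partial i f z * (/ f z * / f z)); auto.
    + intros i z Hz. apply is_partial_inv; [now apply H0 |].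
      eapply class_C_partial; eassumption.
    + intros i. specialize (IH (class_C_pred _ _ _ Hf)).
      repeat apply class_C_mult; auto.
      apply class_C_ext with (fun z => -1 * partial i f z); auto.
      * intros; ring.
      * apply class_C_mult; auto; [now apply class_C_const | apply Hf].
Qed.

(** * Differentiability of continuous square roots *)

Lemma is_derive_scal_sqrt (k : R) (g : R -> R) t l :
  is_derive g t l -> 0 < g t ->
  is_derive (fun t => k * sqrt (g t)) t (k * (l * / (2 * sqrt (g t)))).
Proof.
  intros Hl Hpos. auto_derive.
  - repeat split; [now exists l | exact Hpos].
  - replace (Derive _ t) with l by (symmetry; now apply is_derive_unique). ring.
Qed.

(* Near a point, a continuous nonvanishing square root of [D] is [sqrt D] or
   [- sqrt D], with constant sign. *)
Lemma is_partial_square_root (M : phase -> Prop) i f D z l :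
  open M -> M z -> continuous f z -> f z <> 0 ->
  (forall w, M w -> f w * f w = D w) ->
  is_partial i D z l -> is_partial i f z (/ 2 * (l * / f z)).
Proof.
  intros HM Hz Hc H0 HD Hl.
  assert (Hfc : continuous (fun t => f (set i t z)) (get i z)).
  { apply (continuous_comp (fun t => set i t z) f).
    - apply continuous_set_l.
    - now rewrite set_get. }
  assert (HMl := locally_set M i z HM Hz).
  assert (HDz := HD z Hz).
  (* [k] is the sign of [f z], hence 1 or -1. *)
  set (k := f z / Rabs (f z)).
  assert (L : locally (get i z) (fun t => k * sqrt (D (set i t z)) = f (set i t z))).
  (* By continuity [f] keeps near [z], along the coordinate line, the sign it has at [z]. *)
  { assert (Hs : locally (get i z) (fun t => 0 < f z * f (set i t z))).
    { apply (continuous_mult (K := R_AbsRing) (fun _ => f z) _ _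
               (continuous_const (V := R_UniformSpace) (f z) _) Hfc (fun y => 0 < y)).
      apply open_gt. change (0 < f z * f (set i (get i z) z)). rewrite set_get. nra. }
    generalize (filter_and _ _ HMl Hs). apply filter_imp. intros t [H1 H2].
    unfold k. rewrite <- (HD _ H1). change (f (set i t z) * f (set i t z))
      with (Rsqr (f (set i t z))). rewrite sqrt_Rsqr_abs.
    destruct (Rdichotomy _ _ H0) as [Hn | Hp].
    - rewrite !Rabs_left by nra. now field.
    - rewrite !Rabs_right by nra. now field. }
  apply (is_derive_ext_loc _ _ _ _ L).
  assert (Hsq : sqrt (D z) = Rabs (f z)).
  { rewrite <- HDz. apply sqrt_Rsqr_abs. }
  assert (HR : Rabs (f z) <> 0) by now apply Rabs_no_R0.
  assert (HDpos : 0 < D z) by (rewrite <- HDz; nra).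
  assert (Hd : is_derive (fun t => k * sqrt (D (set i t z))) (get i z)
                 (k * (l * / (2 * sqrt (D z))))).
  { generalize (is_derive_scal_sqrt k (fun t => D (set i t z)) _ _ Hl).
    cbv beta. rewrite set_get. auto. }
  replace (/ 2 * (l * / f z)) with (k * (l * / (2 * sqrt (D z)))); [exact Hd |].
  rewrite Hsq. unfold k.
  assert (Rabs (f z) * Rabs (f z) = f z * f z).
  { rewrite <- Rabs_mult. apply Rabs_right. nra. }
  (* Multiplying by a nonzero factor clears the denominators; the squares of [f z] and of its
     absolute value agree. *)
  apply Rmult_eq_reg_r with (2 * f z * (Rabs (f z) * Rabs (f z))); [| nra].
  field_simplify; try easy.
  replace (Rabs (f z) ^ 2) with (f z ^ 2) by (simpl; lra). ring.
Qed.

(** Bootstrapping from continuity: the derivative is half of [partial i D] over [f], so regularity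
    of [f] at one order gives it at the next, as far as [D] allows. *)
Lemma class_C_square_root n M f D :
  open M -> (forall z, M z -> continuous f z) -> (forall z, M z -> f z <> 0) ->
  (forall z, M z -> f z * f z = D z) -> class_C n M D -> class_C n M f.
Proof.
  intros HM Hc H0 HD. induction n as [|n IH]; intros H.
  - split; [exact Hc | exact I].
  - apply class_C_S_intro with (fun i z => / 2 * (partial i D z * / f z)); auto.
    + intros i z Hz. apply is_partial_square_root with M D; auto.
      eapply class_C_partial; eassumption.
    + intros i. apply class_C_mult; auto; [now apply class_C_const |].
      apply class_C_mult; auto; [apply H |].
      apply class_C_inv; auto. now apply IH, class_C_pred.
Qed.

(** * Closure properties of smooth functions *)

Lemma class_C_subset n (M M' : phase -> Prop) f :
  (forall z, M' z -> M z) -> class_C n M f -> class_C n M' f.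
Proof.
  intros HS. revert f. induction n as [|n IH]; intros f [Hc Hd]; split; auto.
  intros i. destruct (Hd i) as [H1 H2]. split; auto.
Qed.

Lemma smooth_continuous M f z : smooth M f -> M z -> continuous f z.
Proof. intros H. exact (class_C_continuous 0 M f z (H 0%nat)). Qed.

Lemma smooth_is_partial M f i z :
  smooth M f -> M z -> is_partial i f z (partial i f z).
Proof. intros H. exact (class_C_partial 0 M f i z (H 1%nat)). Qed.

Lemma smooth_partial M f i : smooth M f -> smooth M (partial i f).
Proof. intros H n. apply (H (S n)). Qed.

Lemma smooth_ext M f g :
  open M -> (forall z, M z -> f z = g z) -> smooth M f -> smooth M g.
Proof. intros HM E H n. now apply class_C_ext with f. Qed.

Lemma smooth_subset (M M' : phase -> Prop) f :
  (forall z, M' z -> M z) -> smooth M f -> smooth M' f.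
Proof. intros HS H n. now apply class_C_subset with M. Qed.

Lemma smooth_const M c : open M -> smooth M (fun _ => c).
Proof. intros HM n. now apply class_C_const. Qed.

Lemma smooth_get M i : open M -> smooth M (get i).
Proof. intros HM n. now apply class_C_get. Qed.

Lemma smooth_plus M f g :
  open M -> smooth M f -> smooth M g -> smooth M (fun z => f z + g z).
Proof. intros HM Hf Hg n. now apply class_C_plus. Qed.

Lemma smooth_mult M f g :
  open M -> smooth M f -> smooth M g -> smooth M (fun z => f z * g z).
Proof. intros HM Hf Hg n. now apply class_C_mult. Qed.

Lemma smooth_opp M f : open M -> smooth M f -> smooth M (fun z => - f z).
Proof.
  intros HM Hf. apply smooth_ext with (fun z => -1 * f z); auto.
  - intros; ring.
  - apply smooth_mult; auto. now apply smooth_const.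
Qed.

Lemma smooth_minus M f g :
  open M -> smooth M f -> smooth M g -> smooth M (fun z => f z - g z).
Proof. intros HM Hf Hg. apply smooth_plus; auto. now apply smooth_opp. Qed.

Lemma smooth_inv M f :
  open M -> (forall z, M z -> f z <> 0) -> smooth M f -> smooth M (fun z => / f z).
Proof. intros HM H0 Hf n. now apply class_C_inv. Qed.

Lemma smooth_div M f g :
  open M -> (forall z, M z -> g z <> 0) -> smooth M f -> smooth M g ->
  smooth M (fun z => f z / g z).
Proof. intros HM H0 Hf Hg. apply smooth_mult; auto. now apply smooth_inv. Qed.

Lemma smooth_pow M f k : open M -> smooth M f -> smooth M (fun z => f z ^ k).
Proof.
  intros HM Hf. induction k as [|k IH]; cbn [pow].
  - now apply smooth_const.
  - now apply smooth_mult.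
Qed.

Lemma smooth_square_root M f D :
  open M -> (forall z, M z -> continuous f z) -> (forall z, M z -> f z <> 0) ->
  (forall z, M z -> f z * f z = D z) -> smooth M D -> smooth M f.
Proof. intros HM Hc H0 HD H n. now apply class_C_square_root with D. Qed.

Ltac smooth_tac :=
  repeat match goal with
  | |- smooth _ (fun _ => ?c) => apply smooth_const
  | |- smooth ?M u1 => apply (smooth_get M U1)
  | |- smooth ?M u2 => apply (smooth_get M U2)
  | |- smooth ?M pu1 => apply (smooth_get M P1)
  | |- smooth ?M pu2 => apply (smooth_get M P2)
  | |- smooth ?M (partial ?i ?f) => apply (smooth_partial M f i)
  | |- smooth _ (fun z => _ + _) => apply smooth_plus
  | |- smooth _ (fun z => _ - _) => apply smooth_minus
  | |- smooth _ (fun z => _ * _) => apply smooth_mult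
  | |- smooth _ (fun z => _ / _) => apply smooth_div
  | |- smooth _ (fun z => - _) => apply smooth_opp
  | |- smooth _ (fun z => _ ^ _) => apply smooth_pow
  | |- smooth _ (fun z => / _) => apply smooth_inv
  | |- smooth _ _ => eassumption
  | |- open _ => assumption
  end.

(** Schwarz's theorem on the two-dimensional slice [F] through [z], with [s] in slot [i] and [t] in
    slot [j]. Smoothness on the open set [M] supplies the second derivatives near [z] and their
    continuity at [z]. *)
Lemma partial_partial_comm M f i j z :
  open M -> smooth M f -> M z ->
  partial i (partial j f) z = partial j (partial i f) z.
Proof.
  (* The slice needs two distinct slots, so equal coordinates are treated first. *)
  intros HM Hf Hz. destruct (coord_eq_dec i j) as [<- | Hij]; [reflexivity |].
  set (F := fun s t => f (set i s (set j t z))).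
  assert (Ei : forall s t, Derive (fun x => F x t) s = partial i f (set i s (set j t z))).
  { intros s t. unfold partial. rewrite get_set_eq. apply Derive_ext.
    intros x. unfold F. now rewrite set_set. }
  assert (Ej : forall s t, Derive (fun x => F s x) t = partial j f (set i s (set j t z))).
  { intros s t. unfold partial. rewrite get_set_neq, get_set_eq by congruence.
    apply Derive_ext. intros x. unfold F.
    now rewrite (set_comm i j s t), set_set, <- (set_comm i j) by congruence. }
  assert (Eij : forall s t, Derive (fun x => Derive (fun y => F x y) t) s
                 = partial i (partial j f) (set i s (set j t z))).
  { intros s t. unfold partial at 1. rewrite get_set_eq. apply Derive_ext.
    intros x. now rewrite Ej, set_set. }
  assert (Eji : forall s t, Derive (fun x => Derive (fun y => F y x) s) t
                 = partial j (partial i f) (set i s (set j t z))).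
  { intros s t. unfold partial at 1. rewrite get_set_neq, get_set_eq by congruence.
    apply Derive_ext. intros x.
    now rewrite Ei, (set_comm i j s t), set_set, <- (set_comm i j) by congruence. }
  assert (Z : set i (get i z) (set j (get j z) z) = z) by now rewrite !set_get.
  assert (Hl : locally_2d (fun s t => M (set i s (set j t z))) (get i z) (get j z)).
  { apply locally_2d_locally.
    assert (Hc : continuous (fun w : R * R => set i (fst w) (set j (snd w) z))
                   (get i z, get j z)).
    { apply continuous_set; [apply continuous_fst |].
      apply continuous_set; [apply continuous_snd | apply continuous_const]. }
    apply (Hc M). cbn [fst snd]. rewrite Z. now apply HM. }
  assert (Hcont : forall g, smooth M g ->
            continuity_2d_pt (fun s t => g (set i s (set j t z))) (get i z) (get j z)).
  { intros g Hg. apply continuity_2d_pt_filterlim.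
    apply (continuous_comp (fun w : R * R => set i (fst w) (set j (snd w) z)) g
             (get i z, get j z)).
    - apply continuous_set; [apply continuous_fst |].
      apply continuous_set; [apply continuous_snd | apply continuous_const].
    - cbn [fst snd]. rewrite Z. now apply smooth_continuous with M. }
  generalize (Schwarz F (get i z) (get j z)).
  rewrite Eij, Eji, Z. intros S. apply S; clear S.
  - revert Hl. apply locally_2d_impl, locally_2d_forall. intros s t Hst.
    repeat split.
    + generalize (smooth_is_partial M f i _ Hf Hst). intros H. eexists.
      unfold is_partial in H. rewrite get_set_eq in H.
      apply is_derive_ext with (2 := H). intros x. unfold F. now rewrite set_set.
    + generalize (smooth_is_partial M f j _ Hf Hst). intros H. eexists.
      unfold is_partial in H. rewrite get_set_neq, get_set_eq in H by congruence.
      apply is_derive_ext with (2 := H). intros x. unfold F.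
      now rewrite (set_comm i j s t), set_set, <- (set_comm i j) by congruence.
    + generalize (smooth_is_partial M _ i _ (smooth_partial M f j Hf) Hst). intros H.
      eexists. unfold is_partial in H. rewrite get_set_eq in H.
      apply is_derive_ext with (2 := H). intros x. now rewrite Ej, set_set.
    + generalize (smooth_is_partial M _ j _ (smooth_partial M f i Hf) Hst). intros H.
      eexists. unfold is_partial in H. rewrite get_set_neq, get_set_eq in H by congruence.
      apply is_derive_ext with (2 := H). intros x.
      now rewrite Ei, (set_comm i j s t), set_set, <- (set_comm i j) by congruence.
  - apply continuity_2d_pt_ext with (2 := Hcont _ (smooth_partial M _ i (smooth_partial M f j Hf))).
    intros s t. symmetry. apply Eij.
  - apply continuity_2d_pt_ext with (2 := Hcont _ (smooth_partial M _ j (smooth_partial M f i Hf))).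
    intros s t. symmetry. apply Eji.
Qed.

(** * Brackets in a canonical frame *)

Local Notation pb := (bracket canonical).

Lemma bracket_canonical f g z :
  pb f g z = partial U1 f z * partial P1 g z - partial P1 f z * partial U1 g z
             + (partial U2 f z * partial P2 g z - partial P2 f z * partial U2 g z).
Proof. unfold bracket, sum_coord, canonical. ring. Qed.

Lemma bracket_ext (M : phase -> Prop) Pi f f' g g' z :
  open M -> M z -> (forall w, M w -> f w = f' w) -> (forall w, M w -> g w = g' w) ->
  bracket Pi f g z = bracket Pi f' g' z.
Proof.
  intros HM Hz Hf Hg. unfold bracket, sum_coord.
  now rewrite !(partial_ext M _ f f'), !(partial_ext M _ g g').
Qed.

Lemma smooth_bracket_canonical M f g :
  open M -> smooth M f -> smooth M g -> smooth M (pb f g).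
Proof.
  intros HM Hf Hg.
  apply (smooth_ext M _ _ HM (fun z _ => eq_sym (bracket_canonical f g z))). smooth_tac.
Qed.

Lemma bracket_antisym Pi f g z :
  (forall i j, Pi i j z = - Pi j i z) -> bracket Pi f g z = - bracket Pi g f z.
Proof.
  intros Ha.
  assert (D : forall i, Pi i i z = 0) by (intros i; generalize (Ha i i); lra).
  unfold bracket, sum_coord.
  rewrite !D, (Ha U2 U1), (Ha P1 U1), (Ha P2 U1), (Ha P1 U2), (Ha P2 U2), (Ha P2 P1).
  ring.
Qed.

Lemma canonical_antisym i j z : canonical i j z = - canonical j i z.
Proof. destruct i, j; cbn [canonical]; ring. Qed.

Section Frame.

Variables (M : phase -> Prop) (HM : open M).

Lemma partial_plus i f g z :
  smooth M f -> smooth M g -> M z ->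
  partial i (fun w => f w + g w) z = partial i f z + partial i g z.
Proof.
  intros Hf Hg Hz.
  apply is_partial_unique, is_partial_plus; now apply smooth_is_partial with M.
Qed.

Lemma partial_mult i f g z :
  smooth M f -> smooth M g -> M z ->
  partial i (fun w => f w * g w) z = partial i f z * g z + f z * partial i g z.
Proof.
  intros Hf Hg Hz.
  apply is_partial_unique, is_partial_mult; now apply smooth_is_partial with M.
Qed.

Lemma partial_minus i f g z :
  smooth M f -> smooth M g -> M z ->
  partial i (fun w => f w - g w) z = partial i f z - partial i g z.
Proof.
  intros Hf Hg Hz.
  rewrite (partial_ext M i _ (fun w => f w + -1 * g w)); auto; [| intros; ring].
  rewrite partial_plus; auto.
  - rewrite (partial_mult i (fun _ => -1) g z); auto; [| now apply smooth_const].
    rewrite (is_partial_unique _ _ _ _ (is_partial_const i (-1) z)). ring.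
  - smooth_tac.
Qed.

Lemma bracket_plus_l Pi f g h z :
  smooth M f -> smooth M g -> M z ->
  bracket Pi (fun w => f w + g w) h z = bracket Pi f h z + bracket Pi g h z.
Proof.
  intros Hf Hg Hz. unfold bracket, sum_coord.
  rewrite !(fun i => partial_plus i f g z Hf Hg Hz). ring.
Qed.

Lemma bracket_minus_l Pi f g h z :
  smooth M f -> smooth M g -> M z ->
  bracket Pi (fun w => f w - g w) h z = bracket Pi f h z - bracket Pi g h z.
Proof.
  intros Hf Hg Hz. unfold bracket, sum_coord.
  rewrite !(fun i => partial_minus i f g z Hf Hg Hz). ring.
Qed.

Lemma bracket_mult_l Pi f g h z :
  smooth M f -> smooth M g -> M z ->
  bracket Pi (fun w => f w * g w) h z = bracket Pi f h z * g z + f z * bracket Pi g h z.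
Proof.
  intros Hf Hg Hz. unfold bracket, sum_coord.
  rewrite !(fun i => partial_mult i f g z Hf Hg Hz). ring.
Qed.

Lemma bracket_const_l Pi f c h z :
  M z -> (forall w, M w -> f w = c) -> bracket Pi f h z = 0.
Proof.
  intros Hz Hf. rewrite (bracket_ext M Pi f (fun _ => c) h h z); auto.
  unfold bracket, sum_coord.
  rewrite !(fun i => is_partial_unique _ _ _ _ (is_partial_const i c z)). ring.
Qed.

(** The components of the canonical tensor are constant, so each partial acts as a derivation of the
    bracket once the mixed partials are interchanged. *)
Lemma partial_bracket_canonical i f g z :
  smooth M f -> smooth M g -> M z ->
  partial i (pb f g) z = pb (partial i f) g z + pb f (partial i g) z.
Proof.
  intros Hf Hg Hz.
  rewrite (partial_ext M i _ _ z HM Hz (fun w _ => bracket_canonical f g w)).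
  assert (H : forall j k, smooth M (fun w => partial j f w * partial k g w)).
  { intros j k. smooth_tac. }
  assert (H' : forall j k l m,
    smooth M (fun w => partial j f w * partial k g w - partial l f w * partial m g w)).
  { intros j k l m. smooth_tac. }
  rewrite partial_plus, !partial_minus, !partial_mult; auto; try now apply smooth_partial.
  rewrite !bracket_canonical.
  rewrite !(fun j => partial_partial_comm M f i j z HM Hf Hz).
  rewrite !(fun j => partial_partial_comm M g i j z HM Hg Hz). ring.
Qed.

Lemma jacobi_canonical f g h z :
  smooth M f -> smooth M g -> smooth M h -> M z ->
  pb (pb f g) h z + pb (pb g h) f z + pb (pb h f) g z = 0.
Proof.
  intros Hf Hg Hh Hz.
  rewrite (bracket_canonical (pb f g)), (bracket_canonical (pb g h)),
    (bracket_canonical (pb h f)).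
  rewrite !partial_bracket_canonical by auto.
  rewrite !bracket_canonical.
  (* Mixed partials are put in one fixed order, so that [ring] recognizes equal second
     derivatives. *)
  assert (C : forall e, smooth M e ->
    partial U2 (partial U1 e) z = partial U1 (partial U2 e) z /\
    partial P1 (partial U1 e) z = partial U1 (partial P1 e) z /\
    partial P2 (partial U1 e) z = partial U1 (partial P2 e) z /\
    partial P1 (partial U2 e) z = partial U2 (partial P1 e) z /\
    partial P2 (partial U2 e) z = partial U2 (partial P2 e) z /\
    partial P2 (partial P1 e) z = partial P1 (partial P2 e) z).
  { intros e He. repeat split; now apply partial_partial_comm with M. }
  destruct (C f Hf) as (-> & -> & -> & -> & -> & ->).
  destruct (C g Hg) as (-> & -> & -> & -> & -> & ->).
  destruct (C h Hh) as (-> & -> & -> & -> & -> & ->). ring.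
Qed.

(** Jacobi's identity: the commutator of the Hamiltonian fields of [g] and [h] is, up to sign, the
    field of their bracket, which vanishes for a constant bracket. *)
Lemma bracket_bracket_comm f g h c z :
  smooth M f -> smooth M g -> smooth M h -> M z ->
  (forall w, M w -> pb g h w = c) ->
  pb (pb f g) h z = pb (pb f h) g z.
Proof.
  intros Hf Hg Hh Hz Hc.
  generalize (jacobi_canonical f g h z Hf Hg Hh Hz).
  rewrite (bracket_const_l canonical (pb g h) c f z Hz Hc).
  (* Antisymmetry written as a difference, the form to which [bracket_minus_l] applies. *)
  rewrite (bracket_ext M canonical (pb h f) (fun w => 0 - pb f h w) g g z); auto.
  - rewrite (bracket_minus_l canonical (fun _ => 0)); auto.
    + rewrite (bracket_const_l canonical (fun _ => 0) 0 g z); auto. lra.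
    + now apply smooth_const.
    + now apply smooth_bracket_canonical.
  - intros w _. rewrite (bracket_antisym canonical h f) by (intros; apply canonical_antisym). ring.
Qed.

(** * Brackets expressed through two canonical pairs *)

Variables (x1 x2 y1 y2 : phase -> R).
Hypotheses (Hx1 : smooth M x1) (Hx2 : smooth M x2) (Hy1 : smooth M y1) (Hy2 : smooth M y2).

(* The bracket with [{x_i, y_j} = delta_ij m_i], written with
   [d/dx_i = {., y_i}] and [d/dy_i = - {., x_i}]. *)
Definition frame_bracket (m1 m2 f g : phase -> R) (z : phase) : R :=
  m1 z * (pb f x1 z * pb g y1 z - pb f y1 z * pb g x1 z)
  + m2 z * (pb f x2 z * pb g y2 z - pb f y2 z * pb g x2 z).

(** The Leibniz expansion that separates derivatives of the multipliers from iterated brackets of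
    [f] and [g]. *)
Lemma bracket_frame_bracket m1 m2 f g h z :
  smooth M m1 -> smooth M m2 -> smooth M f -> smooth M g -> M z ->
  pb (frame_bracket m1 m2 f g) h z =
  pb m1 h z * (pb f x1 z * pb g y1 z - pb f y1 z * pb g x1 z)
  + m1 z * (pb (pb f x1) h z * pb g y1 z + pb f x1 z * pb (pb g y1) h z
            - (pb (pb f y1) h z * pb g x1 z + pb f y1 z * pb (pb g x1) h z))
  + (pb m2 h z * (pb f x2 z * pb g y2 z - pb f y2 z * pb g x2 z)
  + m2 z * (pb (pb f x2) h z * pb g y2 z + pb f x2 z * pb (pb g y2) h z
            - (pb (pb f y2) h z * pb g x2 z + pb f y2 z * pb (pb g x2) h z))).
Proof.
  intros Hm1 Hm2 Hf Hg Hz.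
  assert (S := fun f g => smooth_bracket_canonical M f g HM).
  assert (S2 := fun f g => smooth_mult M f g HM).
  assert (S3 := fun f g => smooth_minus M f g HM).
  unfold frame_bracket at 1.
  rewrite bracket_plus_l by auto 10.
  rewrite (bracket_mult_l canonical m1 (fun w => pb f x1 w * pb g y1 w - pb f y1 w * pb g x1 w))
    by auto 10.
  rewrite (bracket_mult_l canonical m2 (fun w => pb f x2 w * pb g y2 w - pb f y2 w * pb g x2 w))
    by auto 10.
  rewrite !bracket_minus_l by auto 10.
  rewrite !bracket_mult_l by auto 10. reflexivity.
Qed.

Hypothesis Hcan : has_brackets M canonical x1 x2 y1 y2 (fun _ => 1) (fun _ => 1).

(** The four vanishing brackets say that each multiplier depends only on its own pair, which removes
    the cross terms. What is left cancels because the derivations [{., x_i}] and [{., y_i}]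
    commute. *)
Lemma jacobi_frame_bracket m1 m2 f g h z :
  smooth M m1 -> smooth M m2 -> smooth M f -> smooth M g -> smooth M h -> M z ->
  pb m1 x2 z = 0 -> pb m1 y2 z = 0 -> pb m2 x1 z = 0 -> pb m2 y1 z = 0 ->
  let E := frame_bracket m1 m2 in
  E (E f g) h z + E (E g h) f z + E (E h f) g z = 0.
Proof.
  intros Hm1 Hm2 Hf Hg Hh Hz E1 E2 E3 E4.
  cbv zeta. unfold frame_bracket at 1 3 5.
  rewrite !bracket_frame_bracket by auto. rewrite E1, E2, E3, E4.
  (* The frame functions have constant brackets, 0 or 1, so their Hamiltonian fields commute
     pairwise. *)
  assert (C : forall e, smooth M e ->
    pb (pb e x2) x1 z = pb (pb e x1) x2 z /\
    pb (pb e y1) x1 z = pb (pb e x1) y1 z /\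
    pb (pb e y2) x1 z = pb (pb e x1) y2 z /\
    pb (pb e y1) x2 z = pb (pb e x2) y1 z /\
    pb (pb e y2) x2 z = pb (pb e x2) y2 z /\
    pb (pb e y2) y1 z = pb (pb e y1) y2 z).
  { intros e He. repeat split; symmetry.
    - now apply bracket_bracket_comm with 0; [.. | apply Hcan].
    - now apply bracket_bracket_comm with 1; [.. | apply Hcan].
    - now apply bracket_bracket_comm with 0; [.. | apply Hcan].
    - now apply bracket_bracket_comm with 0; [.. | apply Hcan].
    - now apply bracket_bracket_comm with 1; [.. | apply Hcan].
    - now apply bracket_bracket_comm with 0; [.. | apply Hcan]. }
  destruct (C f Hf) as (-> & -> & -> & -> & -> & ->).
  destruct (C g Hg) as (-> & -> & -> & -> & -> & ->).
  destruct (C h Hh) as (-> & -> & -> & -> & -> & ->). ring.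
Qed.

(* Lagrange brackets: the symplectic form is [sum_i dx_i /\ dy_i]. *)
Hypothesis Hlag : forall i j z, M z ->
  partial i x1 z * partial j y1 z - partial j x1 z * partial i y1 z
  + (partial i x2 z * partial j y2 z - partial j x2 z * partial i y2 z)
  = canonical i j z.

(** The chain rule in the new variables, with d/dx_i = [{., y_i}] and d/dy_i = [- {., x_i}]. *)
Lemma partial_in_frame i f z :
  M z ->
  partial i f z = pb f y1 z * partial i x1 z - pb f x1 z * partial i y1 z
                  + (pb f y2 z * partial i x2 z - pb f x2 z * partial i y2 z).
Proof.
  intros Hz. rewrite !bracket_canonical.
  (* The partial is a contraction of the canonical matrix with the differential of [f]; [Hlag] then
     replaces the entries of that matrix by Lagrange brackets. *)
  transitivity (partial U1 f z * canonical i P1 z - partial P1 f z * canonical i U1 z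
    + (partial U2 f z * canonical i P2 z - partial P2 f z * canonical i U2 z)).
  - destruct i; cbn [canonical]; ring.
  - rewrite <- !Hlag by exact Hz. ring.
Qed.

(** The differentials of the frame functions span, so a bivector is determined by its brackets on
    them: [f] is expanded first, then [g] after antisymmetry. *)
Lemma bracket_in_frame Pi m1 m2 f g z :
  (forall i j w, M w -> Pi i j w = - Pi j i w) ->
  has_brackets M Pi x1 x2 y1 y2 m1 m2 -> M z ->
  bracket Pi f g z = frame_bracket m1 m2 f g z.
Proof.
  intros Ha Hb Hz. unfold frame_bracket.
  assert (L : forall f g, bracket Pi f g z =
    pb f y1 z * bracket Pi x1 g z - pb f x1 z * bracket Pi y1 g z
    + (pb f y2 z * bracket Pi x2 g z - pb f x2 z * bracket Pi y2 g z)).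
  { intros f' g'. unfold bracket at 1 3 5 7 9. unfold sum_coord.
    rewrite !(fun i => partial_in_frame i f' z Hz). ring. }
  assert (A : forall f g, bracket Pi f g z = - bracket Pi g f z).
  { intros f' g'. apply bracket_antisym. intros i j. now apply Ha. }
  assert (D : forall f, bracket Pi f f z = 0) by (intros f'; generalize (A f' f'); lra).
  rewrite L, (A x1 g), (A x2 g), (A y1 g), (A y2 g).
  rewrite (L g x1), (L g x2), (L g y1), (L g y2).
  rewrite !D, (A x2 x1), (A y1 x1), (A y2 x1), (A y1 x2), (A y2 x2), (A y2 y1).
  destruct (Hb z Hz) as (-> & -> & -> & -> & -> & ->). ring.
Qed.

Lemma canonical_in_frame f g z :
  M z -> pb f g z = frame_bracket (fun _ => 1) (fun _ => 1) f g z.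
Proof.
  intros Hz. apply bracket_in_frame; auto. intros; apply canonical_antisym.
Qed.

Lemma poisson_frame Pi m1 m2 :
  bivector_field M Pi -> has_brackets M Pi x1 x2 y1 y2 m1 m2 ->
  smooth M m1 -> smooth M m2 ->
  (forall z, M z -> pb m1 x2 z = 0 /\ pb m1 y2 z = 0 /\ pb m2 x1 z = 0 /\ pb m2 y1 z = 0) ->
  poisson M Pi.
Proof.
  intros HP Hb Hm1 Hm2 H0. split; [exact HP |].
  intros f g h Hf Hg Hh z Hz.
  assert (E : forall f g w, M w -> bracket Pi f g w = frame_bracket m1 m2 f g w).
  { intros f' g' w Hw. apply bracket_in_frame; auto. apply HP. }
  rewrite !E by exact Hz.
  (* The inner bracket gets differentiated, so it is replaced on all of the open set [M] and not at
     [z] alone. *)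
  assert (E' : forall e e' k, frame_bracket m1 m2 (bracket Pi e e') k z
                = frame_bracket m1 m2 (frame_bracket m1 m2 e e') k z).
  { intros e e' k. rewrite <- !E by exact Hz. apply bracket_ext with M; auto. }
  rewrite !E'. destruct (H0 z Hz) as (E1 & E2 & E3 & E4).
  now apply jacobi_frame_bracket.
Qed.

End Frame.

(** * The roots and their momenta *)

(** Since [q1 <> 0], the square root strictly exceeds the absolute value of [q2]. This gives nonzero
    values of [u1], [u2] and [u1 - u2]. *)
Lemma parabolic_chart_sign z : parabolic_chart z -> u1 z < 0 < u2 z.
Proof.
  intros (q1 & q2 & H & -> & ->).
  assert (0 < q1 ^ 2) by (apply pow2_gt_0; exact H).
  assert (Rabs q2 < sqrt (q1 ^ 2 + q2 ^ 2)).
  { rewrite <- sqrt_Rsqr_abs. unfold Rsqr. apply sqrt_lt_1; nra. }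
  destruct (Rabs_def2 q2 (sqrt (q1 ^ 2 + q2 ^ 2))); lra.
Qed.

(* The line [y = slope x + icpt] passes through [(u_1, p_1)] and [(u_2, p_2)]. *)
Definition slope (z : phase) : R := (pu1 z - pu2 z) / (u1 z - u2 z).
Definition icpt (z : phase) : R := (u1 z * pu2 z - u2 z * pu1 z) / (u1 z - u2 z).

Definition kron (i j : coord) : R := if coord_eq_dec i j then 1 else 0.

(** The partials of [slope] and, below, of [icpt], with the momenta eliminated in favour of [s];
    later identities are then rational in the line parameters and [u], [v]. *)
Definition dslope (u v s : R) (i : coord) : R :=
  match i with U1 => - s | U2 => s | P1 => 1 | P2 => -1 end / (u - v).
Definition dicpt (u v s : R) (i : coord) : R :=
  match i with U1 => s * v | U2 => - (s * u) | P1 => - v | P2 => u end / (u - v).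

Lemma is_partial_slope i z :
  u1 z <> u2 z -> is_partial i slope z (dslope (u1 z) (u2 z) (slope z) i).
Proof.
  destruct z as [[[u v] p] q]. intros H.
  unfold is_partial, slope, dslope, u1, u2, pu1, pu2 in *.
  destruct i; cbn [fst snd get set u1 u2 pu1 pu2] in *; unfold u1, u2, pu1, pu2; cbn [fst snd];
    auto_derive; try (field); lra.
Qed.

Lemma is_partial_icpt i z :
  u1 z <> u2 z -> is_partial i icpt z (dicpt (u1 z) (u2 z) (slope z) i).
Proof.
  destruct z as [[[u v] p] q]. intros H.
  unfold is_partial, icpt, slope, dicpt, u1, u2, pu1, pu2 in *.
  destruct i; cbn [fst snd get set u1 u2 pu1 pu2] in *; unfold u1, u2, pu1, pu2; cbn [fst snd];
    auto_derive; try (field); lra.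
Qed.

(* With [p_i = slope u_i + icpt] the three coefficients become polynomials, and
   [b - 2 slope icpt = coefB - coefA (u_1 + u_2)]. *)
Lemma coefA_line a z : u1 z <> u2 z -> coefA a z = a - slope z ^ 2.
Proof. intros H. unfold coefA, slope. field. lra. Qed.

Lemma coefB_line a b z : u1 z <> u2 z ->
  coefB a b z = coefA a z * (u1 z + u2 z) + b - 2 * slope z * icpt z.
Proof. intros H. unfold coefB, coefA, slope, icpt. field. lra. Qed.

Lemma coefC_line a b c z : u1 z <> u2 z ->
  coefC a b c z = coefA a z * (u1 z ^ 2 + u1 z * u2 z + u2 z ^ 2)
    + (b - 2 * slope z * icpt z) * (u1 z + u2 z) + c - icpt z ^ 2.
Proof. intros H. unfold coefC, coefA, slope, icpt. field. lra. Qed.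

(** [Qpol z x] is [x] times the Lagrange interpolation polynomial of the two points [(u_i, p_i)],
    which is the line. *)
Lemma phat_line (x : phase -> R) z :
  u1 z <> u2 z -> x z <> 0 -> phat x z = - (slope z * x z + icpt z).
Proof. intros H H0. unfold phat, Qpol, slope, icpt. field. lra. Qed.

(* [dquad u v s k A e x i] is the derivative of [coefA x^2 + coefB x + coefC]
   along the coordinate [i] at fixed [x], with [s = slope], [k = icpt],
   [A = coefA] and [e = b - 2 slope icpt]. *)
Definition dquad (u v s k A e x : R) (i : coord) : R :=
  let ds := dslope u v s i in
  let dk := dicpt u v s i in
  let du := kron i U1 in
  let dv := kron i U2 in
  - (2 * s * ds) * (x ^ 2 + x * (u + v) + (u ^ 2 + u * v + v ^ 2))
  + A * (x * (du + dv) + (2 * u + v) * du + (u + 2 * v) * dv)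
  + e * (du + dv) - 2 * (ds * k + s * dk) * (x + u + v) - 2 * k * dk.

(** An open set on which the line forms of the coefficients hold, so that they can be differentiated
    through [is_partial_ext]. *)
Definition noncollision (z : phase) : Prop := u1 z <> u2 z.

Lemma locally_neq_0 (f : phase -> R) z :
  continuous f z -> f z <> 0 -> locally z (fun w => f w <> 0).
Proof. intros Hc H0. exact (Hc (fun y => y <> 0) (open_neq 0 _ H0)). Qed.

Lemma open_noncollision : open noncollision.
Proof.
  intros z Hz.
  assert (Hc : continuous (fun w => get U1 w - get U2 w) z).
  { apply (continuous_minus (K := R_AbsRing) (V := R_NormedModule));
      apply continuous_get. }
  generalize (locally_neq_0 _ z Hc (Rminus_eq_contra _ _ Hz)). apply filter_imp. intros w Hw E. apply Hw. cbn [get]. rewrite E. ring.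
Qed.

Ltac partial_tac :=
  repeat match goal with
  | |- is_partial _ (fun _ => ?c) _ _ => apply is_partial_const
  | |- is_partial _ (fun _ => _ + _) _ _ => apply is_partial_plus
  | |- is_partial _ (fun _ => _ * _) _ _ => apply is_partial_mult
  | H : is_partial ?i ?f ?z _ |- is_partial ?i ?f ?z _ => exact H
  end.

Lemma is_partial_quad a b c x i z :
  u1 z <> u2 z ->
  is_partial i (fun w => coefA a w * x ^ 2 + coefB a b w * x + coefC a b c w) z
    (dquad (u1 z) (u2 z) (slope z) (icpt z) (coefA a z)
       (b - 2 * slope z * icpt z) x i).
Proof.
  intros Hz.
  apply is_partial_ext with noncollision
    (* Only sums, products and constants occur here, the shapes that [partial_tac] handles. *)
    (fun w => (a + -1 * (slope w * slope w))
         * (x * x + x * (u1 w + u2 w) + (u1 w * u1 w + u1 w * u2 w + u2 w * u2 w))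
       + (b + -2 * (slope w * icpt w)) * (x + (u1 w + u2 w))
       + (c + -1 * (icpt w * icpt w))).
  - exact open_noncollision.
  - exact Hz.
  - intros w Hw. rewrite coefB_line, coefC_line, coefA_line by exact Hw. ring.
  - assert (Hs := is_partial_slope i z Hz). assert (Hk := is_partial_icpt i z Hz).
    assert (Hu : is_partial i u1 z (kron i U1)) by apply (is_partial_get i U1).
    assert (Hv : is_partial i u2 z (kron i U2)) by apply (is_partial_get i U2).
    eapply is_partial_eq; [partial_tac |].
    rewrite coefA_line by exact Hz. unfold dquad. ring.
Qed.

(* Implicit differentiation of [coefA x^2 + coefB x + coefC = 0]. *)
Lemma partial_root (M : phase -> Prop) a b c (x : phase -> R) i z :
  open M -> M z -> u1 z <> u2 z -> smooth M x -> smooth M (coefA a) ->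
  smooth M (coefB a b) -> smooth M (coefC a b c) ->
  (forall w, M w -> coefA a w * x w ^ 2 + coefB a b w * x w + coefC a b c w = 0) ->
  (2 * coefA a z * x z + coefB a b z) * partial i x z =
  - dquad (u1 z) (u2 z) (slope z) (icpt z) (coefA a z)
       (b - 2 * slope z * icpt z) (x z) i.
Proof.
  intros HM Hz Hne Hx HA HB HC H0.
  assert (Dx := smooth_is_partial M _ i z Hx Hz).
  assert (DA := smooth_is_partial M _ i z HA Hz).
  assert (DB := smooth_is_partial M _ i z HB Hz).
  assert (DC := smooth_is_partial M _ i z HC Hz).
  (* With [x] frozen at its value [x z], only the coefficients are differentiated. *)
  assert (E1 : dquad (u1 z) (u2 z) (slope z) (icpt z) (coefA a z)
       (b - 2 * slope z * icpt z) (x z) i =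
     partial i (coefA a) z * x z ^ 2 + partial i (coefB a b) z * x z
     + partial i (coefC a b c) z).
  { rewrite <- (is_partial_unique _ _ _ _ (is_partial_quad a b c (x z) i z Hne)).
    apply is_partial_unique. eapply is_partial_eq; [partial_tac | cbv beta; ring]. }
  (* Along the root the polynomial vanishes identically, hence so does its full derivative. *)
  assert (E2 : partial i (fun w => coefA a w * (x w * x w) + coefB a b w * x w
                 + coefC a b c w) z = 0).
  { rewrite <- (is_partial_unique _ _ _ _ (is_partial_const i 0 z)).
    apply partial_ext with M; auto. intros w Hw. rewrite <- (H0 w Hw). ring. }
  rewrite E1. apply Rminus_diag_uniq. rewrite <- E2. symmetry.
  apply is_partial_unique. eapply is_partial_eq; [partial_tac | cbv beta; ring].
Qed.

(* [b - 2 s k] is replaced by [- A (w1 + w2 + u + v)], by [B = - A (w1 + w2)]. *)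
Lemma root_brackets (u v s k A w1 w2 : R) (X1 X2 Y1 Y2 : coord -> R) :
  u <> v -> A <> 0 -> w1 <> w2 ->
  (forall i, A * (w1 - w2) * X1 i
     = - dquad u v s k A (- (A * (w1 + w2 + u + v))) w1 i) ->
  (forall i, A * (w2 - w1) * X2 i
     = - dquad u v s k A (- (A * (w1 + w2 + u + v))) w2 i) ->
  (forall i, Y1 i = - (dslope u v s i * w1 + s * X1 i + dicpt u v s i)) ->
  (forall i, Y2 i = - (dslope u v s i * w2 + s * X2 i + dicpt u v s i)) ->
  let P F G := F U1 * G P1 - F P1 * G U1 + (F U2 * G P2 - F P2 * G U2) in
  (P X1 Y1 = 1 /\ P X2 Y2 = 1 /\ P X1 Y2 = 0 /\ P X2 Y1 = 0 /\ P X1 X2 = 0 /\ P Y1 Y2 = 0) /\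
  (forall i j, X1 i * Y1 j - X1 j * Y1 i + (X2 i * Y2 j - X2 j * Y2 i)
     = canonical i j (0, 0, 0, 0)).
Proof.
  intros Huv HA Hw H1 H2 HY1 HY2 P.
  assert (E1 : forall i, X1 i =
    - dquad u v s k A (- (A * (w1 + w2 + u + v))) w1 i / (A * (w1 - w2))).
  { intros i. rewrite <- H1. field. split; lra. }
  assert (E2 : forall i, X2 i =
    - dquad u v s k A (- (A * (w1 + w2 + u + v))) w2 i / (A * (w2 - w1))).
  { intros i. rewrite <- H2. field. split; lra. }
  unfold P. split.
  - repeat split; rewrite ?HY1, ?HY2, ?E1, ?E2; unfold dquad, dslope, dicpt, kron; cbn;
      field; repeat split; lra.
  - intros i j; destruct i, j; rewrite ?HY1, ?HY2, ?E1, ?E2;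
      unfold dquad, dslope, dicpt, kron; cbn; field; repeat split; lra.
Qed.

(** * The separated Hamiltonians *)

Lemma lambda_line a b c (x : phase -> R) z :
  u1 z <> u2 z -> x z <> 0 ->
  coefA a z * x z ^ 2 + coefB a b z * x z + coefC a b c z = 0 ->
  lambda a b c x (phat x) z =
  - (coefA a z * u1 z * u2 z * x z + (u1 z + u2 z) * coefC a b c z) / 2.
Proof.
  intros H H0 E. unfold lambda. rewrite phat_line by assumption.
  apply Rmult_eq_reg_l with 2; [| lra].
  (* Division of the cubic [2 lambda] by the quadratic: the quotient is [u_1 + u_2 - x], and the
     remainder is the claimed linear expression. *)
  transitivity (- (coefA a z * u1 z * u2 z * x z + (u1 z + u2 z) * coefC a b c z)
     + (u1 z + u2 z - x z)
       * (coefA a z * x z ^ 2 + coefB a b z * x z + coefC a b c z)).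
  - rewrite coefB_line, coefC_line, coefA_line by assumption. field.
  - rewrite E. field.
Qed.

Lemma Hhat1_coef a b c z : u1 z <> u2 z ->
  Hhat1 a b c z = u1 z * u2 z * coefB a b z - 2 * (u1 z + u2 z) * coefC a b c z.
Proof. intros H. unfold Hhat1, coefB, coefC. field. lra. Qed.

Lemma Hhat2_coef a b c z : u1 z <> u2 z ->
  Hhat2 a b c z = (u1 z * u2 z) ^ 2
    * (4 * coefA a z * coefC a b c z - coefB a b z ^ 2).
Proof. intros H. unfold Hhat2, coefA, coefB, coefC. field. lra. Qed.

(** A direct computation with the explicit rational functions instead of the separated variables, so
    it also covers points where the roots coincide or are not real. *)
Lemma bracket_Hhat a b c z :
  u1 z <> u2 z -> bracket canonical (Hhat1 a b c) (Hhat2 a b c) z = 0.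
Proof.
  intros H. rewrite bracket_canonical.
  destruct z as [[[u v] p] q]. unfold u1, u2 in H. cbn in H.
  unfold partial, Hhat1, Hhat2, u1, u2, pu1, pu2; cbn [set get fst snd u1 u2 pu1 pu2].
  unfold u1, u2, pu1, pu2; cbn [fst snd].
  assert (Huv : u + - v <> 0) by lra.
  repeat (erewrite (is_derive_unique _ _ _);
    [| auto_derive;
       [repeat split; try exact I; try lra;
        repeat (apply Rmult_integral_contrapositive_currified; try lra)
       | reflexivity]]).
  field. lra.
Qed.

(** * Solving the separation relations; degree in the momenta *)

Lemma separation_relations_iff l1 l2 h1 h2 :
  separation_relations l1 l2 h1 h2 <-> h1 = l1 + l2 /\ h2 = (l1 - l2) ^ 2.
Proof.
  unfold separation_relations. split.
  - intros [H0 H]. assert (S := sqrt_sqrt h2 H0).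
    destruct H as [[H1 H2] | [H1 H2]]; split; try lra; rewrite <- S.
    + replace (sqrt h2) with (l1 - l2) by lra. ring.
    + replace (sqrt h2) with (l2 - l1) by lra. ring.
  (* Here [sqrt h2] is the absolute value of [l1 - l2], and the sign of [l1 - l2] selects one of the
     two sign patterns. *)
  - intros [-> ->]. split; [apply pow2_ge_0 |].
    replace ((l1 - l2) ^ 2) with (Rsqr (l1 - l2)) by (unfold Rsqr; ring).
    rewrite sqrt_Rsqr_abs. unfold Rabs. destruct (Rcase_abs (l1 - l2)); lra.
Qed.

Lemma momentum_polynomial_Hhat2 a b c : momentum_polynomial 4 (Hhat2 a b c).
Proof.
  (* The fourth-order coefficients come from expanding [(p - q) ^ 3 * ((3 * u + v) * p + (u + 3 * v)
     * q)]. *)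
  exists (fun i j u v => u ^ 2 * v ^ 2 * match i, j with
    | 4%nat, 0%nat => (3 * u + v) / (u - v) ^ 3
    | 3%nat, 1%nat => -8 * u / (u - v) ^ 3
    | 2%nat, 2%nat => 6 * (u - v) / (u - v) ^ 3
    | 1%nat, 3%nat => 8 * v / (u - v) ^ 3
    | 0%nat, 4%nat => - (u + 3 * v) / (u - v) ^ 3
    | 2%nat, 0%nat => (- 4 * c - 6 * a * (u ^ 2 + v ^ 2) - 2 * b * (u + 3 * v)) / (u - v) ^ 2
    | 1%nat, 1%nat => (8 * c + 8 * a * (u ^ 2 + u * v + v ^ 2) + 8 * b * (u + v)) / (u - v) ^ 2
    | 0%nat, 2%nat => (- 4 * c - 6 * a * (u ^ 2 + v ^ 2) - 2 * b * (3 * u + v)) / (u - v) ^ 2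
    | 0%nat, 0%nat => a ^ 2 * (3 * u ^ 2 + 2 * u * v + 3 * v ^ 2)
              + a * (2 * b * (u + v) + 4 * c) - b ^ 2
    | _, _ => 0
    end).
  split; intros z Hz; destruct (parabolic_chart_sign z Hz) as [Hu Hv].
  - unfold Hhat2. cbn. field. lra.
  - assert (H3 : (u1 z - u2 z) ^ 3 <> 0) by (apply pow_nonzero; lra).
    (* The coefficients of [p ^ 4] and [q ^ 4] cannot both vanish: [3 u + v = 0] and [u + 3 v = 0]
       would force [u = v = 0]. *)
    destruct (Req_dec (3 * u1 z + u2 z) 0) as [E | E].
    + exists 0%nat. split; [lia |]. cbn [Nat.sub].
      apply Rmult_integral_contrapositive_currified;
        [apply Rmult_integral_contrapositive_currified; apply pow_nonzero; lra |].
      apply Rmult_integral_contrapositive_currified;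
        [lra | now apply Rinv_neq_0_compat].
    + exists 4%nat. split; [lia |]. cbn [Nat.sub].
      apply Rmult_integral_contrapositive_currified;
        [apply Rmult_integral_contrapositive_currified; apply pow_nonzero; lra |].
      apply Rmult_integral_contrapositive_currified;
        [lra | now apply Rinv_neq_0_compat].
Qed.

(** * Vieta's formulas and smoothness of the new variables *)

Lemma quadratic_roots_Vieta A B C r1 r2 :
  quadratic_roots A B C r1 r2 -> A <> 0 /\ B = - (A * (r1 + r2)) /\ C = A * r1 * r2.
(* The values of the polynomial identity at 0 and 1 determine [C] and [B]. *)
Proof. intros [HA H]. generalize (H 0) (H 1). intros E0 E1. repeat split; lra. Qed.

Lemma quadratic_roots_root A B C r1 r2 :
  quadratic_roots A B C r1 r2 -> A * r1 ^ 2 + B * r1 + C = 0 /\ A * r2 ^ 2 + B * r2 + C = 0.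
Proof. intros [_ H]. rewrite !H. split; ring. Qed.

Lemma quadratic_roots_sym A B C r1 r2 :
  quadratic_roots A B C r1 r2 -> quadratic_roots A B C r2 r1.
Proof. intros [HA H]. split; [exact HA |]. intros x. rewrite H. ring. Qed.

Lemma smooth_coef (M : phase -> Prop) a b c :
  open M -> (forall z, M z -> u1 z <> u2 z) ->
  smooth M (coefA a) /\ smooth M (coefB a b) /\ smooth M (coefC a b c).
Proof.
  intros HM H.
  assert (H2 : forall z, M z -> (u1 z - u2 z) ^ 2 <> 0).
  { intros z Hz. apply pow_nonzero. specialize (H z Hz). lra. }
  assert (H1 : forall z, M z -> u1 z - u2 z <> 0).
  { intros z Hz. specialize (H z Hz). lra. }
  unfold coefA, coefB, coefC. repeat split; smooth_tac; assumption.
Qed.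

Lemma smooth_slope M : open M -> (forall z, M z -> u1 z <> u2 z) -> smooth M slope.
Proof.
  intros HM H. unfold slope. smooth_tac. intros z Hz. specialize (H z Hz). lra.
Qed.

Lemma smooth_icpt M : open M -> (forall z, M z -> u1 z <> u2 z) -> smooth M icpt.
Proof.
  intros HM H. unfold icpt. smooth_tac. intros z Hz. specialize (H z Hz). lra.
Qed.

Lemma smooth_simple_root M (A B C r1 r2 : phase -> R) :
  open M -> smooth M A -> smooth M B -> smooth M C ->
  (forall z, M z -> continuous r1 z) -> (forall z, M z -> continuous r2 z) ->
  (forall z, M z -> quadratic_roots (A z) (B z) (C z) (r1 z) (r2 z)) ->
  (forall z, M z -> r1 z <> r2 z) -> smooth M r1.
Proof.
  intros HM HA HB HC H1 H2 Hq Hne.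
  assert (V := fun z Hz => quadratic_roots_Vieta _ _ _ _ _ (Hq z Hz)).
  assert (HW : smooth M (fun z => A z * (r1 z - r2 z))).
  { apply smooth_square_root with (fun z => B z ^ 2 - 4 * (A z * C z)); auto.
    - intros z Hz. apply (continuous_mult (K := R_AbsRing)).
      + now apply smooth_continuous with M.
      + apply (continuous_minus (K := R_AbsRing) (V := R_NormedModule)); auto.
    - intros z Hz. destruct (V z Hz) as [HA0 _]. specialize (Hne z Hz).
      apply Rmult_integral_contrapositive_currified; lra.
    - intros z Hz. destruct (V z Hz) as (_ & -> & ->). ring.
    - smooth_tac. }
  (* The quadratic formula, with [A (r1 - r2)] as the chosen root of the discriminant, returns
     [r1]. *)
  apply smooth_ext with (fun z => (A z * (r1 z - r2 z) - B z) / (2 * A z)); auto.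
  - intros z Hz. destruct (V z Hz) as (HA0 & -> & _). field. exact HA0.
  - apply smooth_div; auto.
    + intros z Hz. destruct (V z Hz) as [HA0 _]. lra.
    + now apply smooth_minus.
    + smooth_tac.
Qed.

Lemma smooth_phat M x :
  open M -> (forall z, M z -> u1 z <> u2 z) -> (forall z, M z -> x z <> 0) ->
  smooth M x -> smooth M (phat x).
Proof.
  intros HM Hu H0 Hx.
  apply smooth_ext with (fun z => - (slope z * x z + icpt z)); auto.
  - intros z Hz. symmetry. now apply phat_line; auto.
  - assert (Hs := smooth_slope M HM Hu). assert (Hk := smooth_icpt M HM Hu). smooth_tac.
Qed.

Lemma partial_phat M x i z :
  open M -> (forall z, M z -> u1 z <> u2 z) -> (forall z, M z -> x z <> 0) ->
  smooth M x -> M z ->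
  partial i (phat x) z =
  - (dslope (u1 z) (u2 z) (slope z) i * x z + slope z * partial i x z
     + dicpt (u1 z) (u2 z) (slope z) i).
Proof.
  intros HM Hu H0 Hx Hz.
  rewrite (partial_ext M i _ (fun z => -1 * (slope z * x z + icpt z)) z); auto.
  - assert (Hs := is_partial_slope i z (Hu z Hz)).
    assert (Hk := is_partial_icpt i z (Hu z Hz)).
    assert (Hd := smooth_is_partial M x i z Hx Hz).
    apply is_partial_unique. eapply is_partial_eq; [partial_tac | cbv beta; ring].
  - intros w Hw. rewrite phat_line by auto. ring.
Qed.

Lemma smooth_lambda M a b c x y :
  open M -> smooth M x -> smooth M y -> smooth M (lambda a b c x y).
Proof. intros HM Hx Hy. unfold lambda. smooth_tac. intros; lra. Qed.

(** The chain rule for [lambda] as a function of one pair; it reduces brackets of [lambda_i] with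
    the other pair to brackets of the variables. *)
Lemma bracket_lambda M a b c x y h z :
  smooth M x -> smooth M y -> M z ->
  bracket canonical (lambda a b c x y) h z =
  (y z ^ 2 - 3 * a * x z ^ 2 - 2 * b * x z - c) / 2 * bracket canonical x h z
  + x z * y z * bracket canonical y h z.
Proof.
  intros Hx Hy Hz.
  assert (D : forall i, partial i (lambda a b c x y) z =
    (y z ^ 2 - 3 * a * x z ^ 2 - 2 * b * x z - c) / 2 * partial i x z
    + x z * y z * partial i y z).
  { intros i.
    assert (Dx := smooth_is_partial M x i z Hx Hz).
    assert (Dy := smooth_is_partial M y i z Hy Hz).
    rewrite (partial_ext (fun _ => True) i _ (fun w => / 2 * (x w * (y w * y w)
       + - a * (x w * (x w * x w)) + - b * (x w * x w) + - c * x w)) z).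
    - apply is_partial_unique. eapply is_partial_eq; [partial_tac | cbv beta; field].
    - apply open_true.
    - exact I.
    - intros w _. unfold lambda. field. }
  rewrite !bracket_canonical, !D. ring.
Qed.

(** * Tensors with prescribed brackets of the new variables *)

Lemma ham_field_bracket Pi F i z : ham_field Pi F i z = bracket Pi (get i) F z.
Proof.
  unfold ham_field, bracket, sum_coord.
  rewrite !(fun k => is_partial_unique _ _ _ _ (is_partial_get k i z)).
  destruct i; cbn; ring.
Qed.

Lemma bracket_lin_comb al Pi1 be Pi2 f g z :
  bracket (lin_comb al Pi1 be Pi2) f g z = al * bracket Pi1 f g z + be * bracket Pi2 f g z.
Proof. unfold bracket, lin_comb, sum_coord. ring. Qed.

(** The bivector [sum_i m_i d/dx_i /\ d/dy_i], with the coordinate fields realized as Hamiltonian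
    fields of [y_i] and, up to sign, [x_i]. It witnesses the existence of the second bracket. *)
Definition frame_tensor (x1 x2 y1 y2 m1 m2 : phase -> R) : tensor2 := fun i j z =>
  m1 z * (ham_field canonical x1 i z * ham_field canonical y1 j z
          - ham_field canonical y1 i z * ham_field canonical x1 j z)
  + m2 z * (ham_field canonical x2 i z * ham_field canonical y2 j z
          - ham_field canonical y2 i z * ham_field canonical x2 j z).

Lemma bracket_frame_tensor x1 x2 y1 y2 m1 m2 f g z :
  bracket (frame_tensor x1 x2 y1 y2 m1 m2) f g z
  = frame_bracket x1 x2 y1 y2 m1 m2 f g z.
Proof.
  unfold frame_bracket. rewrite !bracket_canonical.
  unfold bracket, frame_tensor, ham_field, sum_coord, canonical. ring.
Qed.

Lemma bracket_canonical_self f z : bracket canonical f f z = 0.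
Proof. rewrite bracket_canonical. ring. Qed.

Lemma has_brackets_frame_tensor M x1 x2 y1 y2 m1 m2 :
  has_brackets M canonical x1 x2 y1 y2 (fun _ => 1) (fun _ => 1) ->
  has_brackets M (frame_tensor x1 x2 y1 y2 m1 m2) x1 x2 y1 y2 m1 m2.
Proof.
  intros Hc z Hz. destruct (Hc z Hz) as (E1 & E2 & E3 & E4 & E5 & E6).
  rewrite !bracket_frame_tensor. unfold frame_bracket.
  rewrite !bracket_canonical_self.
  assert (A : forall f g, bracket canonical f g z = - bracket canonical g f z).
  { intros f g. rewrite !bracket_canonical. ring. }
  rewrite (A y1 x1), (A y2 x2), (A y1 x2), (A y2 x1), (A x2 x1), (A y2 y1).
  rewrite E1, E2, E3, E4, E5, E6. repeat split; ring.
Qed.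

Lemma bivector_field_frame_tensor M x1 x2 y1 y2 m1 m2 :
  open M -> smooth M x1 -> smooth M x2 -> smooth M y1 -> smooth M y2 ->
  smooth M m1 -> smooth M m2 ->
  bivector_field M (frame_tensor x1 x2 y1 y2 m1 m2).
Proof.
  intros HM Hx1 Hx2 Hy1 Hy2 Hm1 Hm2. split.
  - assert (S : forall h i, smooth M h -> smooth M (ham_field canonical h i)).
    { intros h i Hh. unfold ham_field, sum_coord, canonical.
      destruct i; smooth_tac. }
    intros i j. unfold frame_tensor.
    pose proof (S x1 i Hx1); pose proof (S x2 i Hx2);
    pose proof (S y1 i Hy1); pose proof (S y2 i Hy2);
    pose proof (S x1 j Hx1); pose proof (S x2 j Hx2);
    pose proof (S y1 j Hy1); pose proof (S y2 j Hy2). smooth_tac.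
  - intros i j z _. unfold frame_tensor. ring.
Qed.

Lemma bivector_field_canonical M : open M -> bivector_field M canonical.
Proof.
  intros HM. split.
  - intros i j. unfold canonical. destruct i, j; now apply smooth_const.
  - intros i j z _. apply canonical_antisym.
Qed.

Lemma bivector_field_lin_comb M al Pi1 be Pi2 :
  open M -> bivector_field M Pi1 -> bivector_field M Pi2 ->
  bivector_field M (lin_comb al Pi1 be Pi2).
Proof.
  intros HM [S1 A1] [S2 A2]. split.
  - intros i j. specialize (S1 i j). specialize (S2 i j). unfold lin_comb. smooth_tac.
  - intros i j z Hz. unfold lin_comb. rewrite (A1 i j), (A2 i j) by exact Hz. ring.
Qed.

(** [root_brackets] at each point, fed by implicit differentiation. For simple roots the factor
    [2 A x + B] is nonzero, so the partials of the roots are determined. *)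
Lemma hat_brackets (M : phase -> Prop) a b c x1 x2 :
  open M -> (forall z, M z -> u1 z <> u2 z) ->
  smooth M x1 -> smooth M x2 ->
  (forall z, M z ->
     quadratic_roots (coefA a z) (coefB a b z) (coefC a b c z) (x1 z) (x2 z)) ->
  (forall z, M z -> x1 z <> 0 /\ x2 z <> 0) -> (forall z, M z -> x1 z <> x2 z) ->
  has_brackets M canonical x1 x2 (phat x1) (phat x2) (fun _ => 1) (fun _ => 1) /\
  (forall i j z, M z ->
    partial i x1 z * partial j (phat x1) z - partial j x1 z * partial i (phat x1) z
    + (partial i x2 z * partial j (phat x2) z - partial j x2 z * partial i (phat x2) z)
    = canonical i j z).
Proof.
  intros HM Hu Hx1 Hx2 Hq Hnz Hne.
  destruct (smooth_coef M a b c HM Hu) as (HA & HB & HC).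
  assert (H1 : forall z, M z -> x1 z <> 0) by (intros z Hz; apply Hnz, Hz).
  assert (H2 : forall z, M z -> x2 z <> 0) by (intros z Hz; apply Hnz, Hz).
  assert (K : forall z, M z ->
    let X1 i := partial i x1 z in let X2 i := partial i x2 z in
    let Y1 i := partial i (phat x1) z in let Y2 i := partial i (phat x2) z in
    let P F G := F U1 * G P1 - F P1 * G U1 + (F U2 * G P2 - F P2 * G U2) in
    (P X1 Y1 = 1 /\ P X2 Y2 = 1 /\ P X1 Y2 = 0 /\ P X2 Y1 = 0 /\ P X1 X2 = 0 /\ P Y1 Y2 = 0) /\
    (forall i j, X1 i * Y1 j - X1 j * Y1 i + (X2 i * Y2 j - X2 j * Y2 i)
       = canonical i j (0, 0, 0, 0))).
  { intros z Hz. cbv zeta.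
    destruct (quadratic_roots_Vieta _ _ _ _ _ (Hq z Hz)) as (HA0 & VB & _).
    assert (E := coefB_line a b z (Hu z Hz)).
    (* Vieta's formula for the sum of the roots eliminates [b]. *)
    assert (Ee : b - 2 * slope z * icpt z
                 = - (coefA a z * (x1 z + x2 z + u1 z + u2 z))) by lra.
    apply (root_brackets (u1 z) (u2 z) (slope z) (icpt z) (coefA a z) (x1 z) (x2 z)
      (fun i => partial i x1 z) (fun i => partial i x2 z)
      (fun i => partial i (phat x1) z) (fun i => partial i (phat x2) z)); auto.
    - intros i. rewrite <- Ee, <- (partial_root M a b c x1 i z); auto.
      + rewrite VB. ring.
      + intros w Hw. apply (quadratic_roots_root _ _ _ _ _ (Hq w Hw)).
    - intros i. rewrite <- Ee, <- (partial_root M a b c x2 i z); auto.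
      + rewrite VB. ring.
      + intros w Hw. apply (quadratic_roots_root _ _ _ _ _ (Hq w Hw)).
    - intros i. rewrite (partial_phat M) by auto. ring.
    - intros i. rewrite (partial_phat M) by auto. ring. }
  split.
  - intros z Hz. destruct (K z Hz) as [E _]. rewrite !bracket_canonical. exact E.
  (* [canonical] is constant, so its value at the origin serves for [z]. *)
  - intros i j z Hz. destruct (K z Hz) as [_ E]. exact (E i j).
Qed.

(** * Compatibility and the bi-Hamiltonian property *)

Section BiHamiltonian.

Variables (N : phase -> Prop) (x1 x2 y1 y2 l1 l2 H : phase -> R) (Pi : tensor2).
Hypotheses (HN : open N)
  (Hx1 : smooth N x1) (Hx2 : smooth N x2) (Hy1 : smooth N y1) (Hy2 : smooth N y2)
  (Hl1 : smooth N l1) (Hl2 : smooth N l2) (HH : smooth N H)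
  (Hcan : has_brackets N canonical x1 x2 y1 y2 (fun _ => 1) (fun _ => 1))
  (Hlag : forall i j z, N z ->
    partial i x1 z * partial j y1 z - partial j x1 z * partial i y1 z
    + (partial i x2 z * partial j y2 z - partial j x2 z * partial i y2 z)
    = canonical i j z)
  (Hnz : forall z, N z -> l1 z <> 0 /\ l2 z <> 0)
  (Hsep : forall z, N z ->
     bracket canonical l1 x2 z = 0 /\ bracket canonical l1 y2 z = 0 /\
     bracket canonical l2 x1 z = 0 /\ bracket canonical l2 y1 z = 0)
  (HHl : forall z, N z -> H z = 2 * (l1 z + l2 z))
  (HPi : bivector_field N Pi)
  (Hbr : has_brackets N Pi x1 x2 y1 y2 (fun z => / l1 z) (fun z => / l2 z)).

(** The multipliers of a linear combination of the two brackets have the form [al + be / l]; they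
    commute with [h] whenever [l] does. *)
Lemma bracket_affine_inv al be l h z :
  smooth N l -> (forall w, N w -> l w <> 0) -> N z ->
  bracket canonical l h z = 0 ->
  bracket canonical (fun w => al + be * / l w) h z = 0.
Proof.
  intros Hl H0 Hz E.
  assert (Hi : smooth N (fun w => / l w)) by now apply smooth_inv.
  assert (Hal : smooth N (fun _ => al)) by now apply smooth_const.
  assert (Hbe : smooth N (fun _ => be)) by now apply smooth_const.
  assert (Hbi := smooth_mult N _ _ HN Hbe Hi).
  rewrite (bracket_plus_l N canonical (fun _ => al) (fun w => be * / l w)) by auto.
  rewrite (bracket_const_l N HN canonical (fun _ => al) al) by auto.
  rewrite (bracket_mult_l N canonical (fun _ => be) (fun w => / l w)) by auto.
  rewrite (bracket_const_l N HN canonical (fun _ => be) be) by auto.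
  (* Apply the derivation to [l * / l = 1]. *)
  assert (E' := bracket_mult_l N canonical l (fun w => / l w) h z Hl Hi Hz).
  rewrite (bracket_const_l N HN canonical (fun w => l w * / l w) 1), E in E'; auto.
  - assert (bracket canonical (fun w => / l w) h z = 0) as ->; [| ring].
    apply Rmult_eq_reg_l with (l z); [lra | now apply H0].
  - intros w Hw. apply Rinv_r, H0, Hw.
Qed.

(** A linear combination is again diagonal in the frame, with multipliers [al + be / l_i] depending
    only on the [i]-th pair, so [poisson_frame] covers every [al] and [be]. *)
Lemma compatible_frame : compatible N canonical Pi.
Proof.
  intros al be.
  assert (N1 : forall z, N z -> l1 z <> 0) by (intros z Hz; apply Hnz, Hz).
  assert (N2 : forall z, N z -> l2 z <> 0) by (intros z Hz; apply Hnz, Hz).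
  apply (poisson_frame N HN x1 x2 y1 y2 Hx1 Hx2 Hy1 Hy2 Hcan Hlag _
    (fun z => al + be * / l1 z) (fun z => al + be * / l2 z)).
  - apply bivector_field_lin_comb; auto. now apply bivector_field_canonical.
  - intros z Hz. rewrite !bracket_lin_comb.
    destruct (Hcan z Hz) as (-> & -> & -> & -> & -> & ->).
    destruct (Hbr z Hz) as (-> & -> & -> & -> & -> & ->). repeat split; ring.
  - smooth_tac. exact N1.
  - smooth_tac. exact N2.
  - intros z Hz. destruct (Hsep z Hz) as (E1 & E2 & E3 & E4).
    repeat split; apply bracket_affine_inv; auto.
Qed.

(* In the frame, [(1/l_i) d(l_1^2 + l_2^2) = 2 dl_i = dH]. *)
Lemma bi_hamiltonian_frame : bi_hamiltonian N canonical Pi (ham_field canonical H).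
Proof.
  split; [exact compatible_frame | split].
  - exists H. now split.
  - exists (fun w => l1 w * l1 w + l2 w * l2 w). split.
    + smooth_tac.
    + intros i z Hz. rewrite !ham_field_bracket.
      rewrite (canonical_in_frame N x1 x2 y1 y2 Hcan Hlag _ _ z Hz).
      rewrite (bracket_in_frame N x1 x2 y1 y2 Hlag Pi _ _ _ _ z
                 (fun i j w Hw => proj2 HPi i j w Hw) Hbr Hz).
      unfold frame_bracket.
      assert (Hl1' := smooth_mult N l1 l1 HN Hl1 Hl1).
      assert (Hl2' := smooth_mult N l2 l2 HN Hl2 Hl2).
      assert (EF : forall h, bracket canonical (fun w => l1 w * l1 w + l2 w * l2 w) h z
        = 2 * (l1 z * bracket canonical l1 h z + l2 z * bracket canonical l2 h z)).
      { intros h. rewrite (bracket_plus_l N canonical (fun w => l1 w * l1 w)); auto.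
        rewrite !(bracket_mult_l N); auto. ring. }
      assert (EH : forall h, bracket canonical H h z
        = 2 * (bracket canonical l1 h z + bracket canonical l2 h z)).
      { intros h.
        rewrite (bracket_ext N canonical H (fun w => (l1 w + l2 w) + (l1 w + l2 w)) h h z); auto.
        - assert (S := smooth_plus N l1 l2 HN Hl1 Hl2).
          rewrite (bracket_plus_l N canonical (fun w => l1 w + l2 w)); auto.
          rewrite (bracket_plus_l N canonical l1 l2); auto. ring.
        - intros w Hw. rewrite HHl by exact Hw. ring. }
      rewrite !EF, !EH.
      (* The cross brackets drop out, and the factors [/ l_i] and [l_i] cancel pair by pair. *)
      destruct (Hsep z Hz) as (-> & -> & -> & ->).
      destruct (Hnz z Hz). field. now split.
Qed.

End BiHamiltonian.

(** * The three assertions for the roots and their momenta *)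

Theorem mainTheorem6 (a b c : R) (M : phase -> Prop) (x1 x2 : phase -> R)
  (HMopen : open M)
  (HMchart : forall z, M z -> parabolic_chart z)
  (Hcont1 : forall z, M z -> continuous x1 z)
  (Hcont2 : forall z, M z -> continuous x2 z)
  (Hroots : forall z, M z ->
     quadratic_roots (coefA a z) (coefB a b z) (coefC a b c z) (x1 z) (x2 z))
  (Hnz : forall z, M z -> x1 z <> 0 /\ x2 z <> 0) :
  let y1 := phat x1 in
  let y2 := phat x2 in
  let l1 := lambda a b c x1 y1 in
  let l2 := lambda a b c x2 y2 in
  let N := fun z => M z /\ x1 z <> x2 z in
  let N' := fun z => N z /\ l1 z <> 0 /\ l2 z <> 0 in
  (* 1 *)
  ((smooth N x1 /\ smooth N x2 /\ smooth N y1 /\ smooth N y2) /\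
   has_brackets N canonical x1 x2 y1 y2 (fun _ => 1) (fun _ => 1)) /\
  (* 2 *)
  ((forall z, M z -> forall h1 h2 : R,
      separation_relations (l1 z) (l2 z) h1 h2 <->
      h1 = Hhat1 a b c z / 2 /\ h2 = - Hhat2 a b c z / 4) /\
   (forall z, parabolic_chart z ->
      bracket canonical (Hhat1 a b c) (Hhat2 a b c) z = 0) /\
   momentum_polynomial 4 (Hhat2 a b c)) /\
  (* 3 *)
  ((exists Pi, bivector_field N' Pi /\
      has_brackets N' Pi x1 x2 y1 y2 (fun z => / l1 z) (fun z => / l2 z)) /\
   (forall Pi, bivector_field N' Pi ->
      has_brackets N' Pi x1 x2 y1 y2 (fun z => / l1 z) (fun z => / l2 z) ->
      bi_hamiltonian N' canonical Pi (ham_field canonical (Hhat1 a b c)))).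
Proof.
  intros y1 y2 l1 l2 N N'.
  assert (Hchart : forall z, parabolic_chart z -> u1 z <> u2 z).
  { intros z Hz. generalize (parabolic_chart_sign z Hz). lra. }
  assert (Hu : forall z, M z -> u1 z <> u2 z) by auto.
  assert (HN : open N).
  { intros z [Hz Hne].
    assert (Hc : continuous (fun w => x1 w - x2 w) z).
    { apply (continuous_minus (K := R_AbsRing) (V := R_NormedModule)); auto. }
    generalize (filter_and _ _ (HMopen z Hz)
                  (locally_neq_0 _ z Hc (Rminus_eq_contra _ _ Hne))).
    apply filter_imp. intros w [Hw Hw']. split; [exact Hw | lra]. }
  assert (HuN : forall z, N z -> u1 z <> u2 z) by (intros z [Hz _]; auto).
  assert (HqN : forall z, N z ->
    quadratic_roots (coefA a z) (coefB a b z) (coefC a b c z) (x1 z) (x2 z))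
    by (intros z [Hz _]; auto).
  assert (HnzN : forall z, N z -> x1 z <> 0 /\ x2 z <> 0) by (intros z [Hz _]; auto).
  destruct (smooth_coef N a b c HN HuN) as (HA & HB & HC).
  assert (Hx1 : smooth N x1).
  { apply (smooth_simple_root N (coefA a) (coefB a b) (coefC a b c) x1 x2); auto;
      intros z [Hz Hne]; auto. }
  assert (Hx2 : smooth N x2).
  { apply (smooth_simple_root N (coefA a) (coefB a b) (coefC a b c) x2 x1); auto;
      intros z [Hz Hne]; auto. now apply quadratic_roots_sym; auto. }
  assert (Hy1 : smooth N y1).
  { apply smooth_phat; auto. intros z Hz. apply HnzN, Hz. }
  assert (Hy2 : smooth N y2).
  { apply smooth_phat; auto. intros z Hz. apply HnzN, Hz. }
  destruct (hat_brackets N a b c x1 x2 HN HuN Hx1 Hx2 HqN HnzN (fun z Hz => proj2 Hz))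
    as [Hcan Hlag].
  fold y1 y2 in Hcan, Hlag.
  assert (Hl1 : smooth N l1) by now apply smooth_lambda.
  assert (Hl2 : smooth N l2) by now apply smooth_lambda.
  assert (HN' : open N').
  { intros z [Hz [H1 H2]].
    generalize (filter_and _ _ (HN z Hz) (filter_and _ _
      (locally_neq_0 _ z (smooth_continuous N _ z Hl1 Hz) H1)
      (locally_neq_0 _ z (smooth_continuous N _ z Hl2 Hz) H2))).
    apply filter_imp. intros w (Hw & Hw1 & Hw2). exact (conj Hw (conj Hw1 Hw2)). }
  assert (HS : forall z, N' z -> N z) by (intros z [Hz _]; exact Hz).
  (* A pointwise algebraic fact from Vieta's formulas, so it holds on all of [M], double roots
     included. *)
  assert (Hlam : forall z, M z ->
    l1 z + l2 z = Hhat1 a b c z / 2 /\ (l1 z - l2 z) ^ 2 = - Hhat2 a b c z / 4).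
  { intros z Hz. destruct (Hnz z Hz) as [H1 H2].
    destruct (quadratic_roots_root _ _ _ _ _ (Hroots z Hz)) as [R1 R2].
    destruct (quadratic_roots_Vieta _ _ _ _ _ (Hroots z Hz)) as (_ & VB & VC).
    unfold l1, l2, y1, y2. rewrite !lambda_line by auto.
    rewrite Hhat1_coef, Hhat2_coef by auto. rewrite VB, VC. split; field. }
  split; [now split |]. split; [split; [| split] | split].
  - intros z Hz h1 h2. rewrite separation_relations_iff.
    destruct (Hlam z Hz) as [-> ->]. reflexivity.
  - intros z Hz. apply bracket_Hhat; auto.
  - apply momentum_polynomial_Hhat2.
  - exists (frame_tensor x1 x2 y1 y2 (fun z => / l1 z) (fun z => / l2 z)). split.
    + apply bivector_field_frame_tensor; auto;
        try (apply smooth_subset with N; assumption).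
      * apply smooth_inv; auto; [now intros z [_ [? _]] |].
        now apply smooth_subset with N.
      * apply smooth_inv; auto; [now intros z [_ [_ ?]] |].
        now apply smooth_subset with N.
    + apply has_brackets_frame_tensor. intros z Hz. apply Hcan, HS, Hz.
  - intros Pi HPi Hbr.
    apply (bi_hamiltonian_frame N' x1 x2 y1 y2 l1 l2); auto;
      try (apply smooth_subset with N; assumption).
    + assert (S := smooth_coef N' a b c HN' (fun z Hz => HuN z (HS z Hz))).
      destruct S as (SA & SB & SC).
      (* Smoothness of [Hhat1] is read off from its expression in the coefficients of the
         quadratic. *)
      apply smooth_ext with
        (fun z => u1 z * u2 z * coefB a b z - 2 * (u1 z + u2 z) * coefC a b c z); auto.
      * intros z Hz. symmetry. apply Hhat1_coef; auto.
      * smooth_tac.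
    + intros z Hz. apply Hcan, HS, Hz.
    + now intros z [_ Hz].
    + intros z Hz. apply HS in Hz.
      (* The chain rule turns each cross bracket into canonical brackets between different pairs,
         which all vanish. *)
      destruct (Hcan z Hz) as (E1 & E2 & E3 & E4 & E5 & E6).
      unfold l1, l2. rewrite !(bracket_lambda N) by auto.
      assert (A : forall f g, bracket canonical f g z = - bracket canonical g f z).
      { intros f g. apply bracket_antisym. intros; apply canonical_antisym. }
      rewrite (A y1 x2), (A y2 x1), (A y2 y1), (A x2 x1), E3, E4, E5, E6.
      repeat split; ring.
    + intros z [[Hz _] _]. destruct (Hlam z Hz) as [E _]. lra.
Qed.
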